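(* Let $G$ be distributed according to the spherical ensemble $\mathrm{Sph}(N)$, with spectrum $\Lambda=(\lambda_1,\dots,\lambda_N)$. The conditional expectation of $\frac1N\mathrm{Tr}\,G^*G$ with respect to $\Lambda$ is $$\mathbb{E}_\Lambda\left(\frac1N\mathrm{Tr}\,G^*G\right)=\prod_{i=1}^N\left(1+\frac{1+|\lambda_i|^2}{N}\right)-2.$$
   Context: $\mathrm{Sph}(N)$ is the law of $G=G_1G_2^{-1}$, where $G_1,G_2$ are independent $N\times N$ complex Ginibre matrices (i.i.d. centered complex Gaussian entries). The eigenvalues $\lambda_1,\dots,\lambda_N$ are labelled exchangeably. Schur form and conditioning: $G$ can be written $G=UTU^*$ with $U$ unitary (suitably chosen at random) and $T$ upper triangular with diagonal $(\lambda_1,\dots,\lambda_N)$, such that $T$ has density proportional to $\prod_{i<j}|\lambda_i-\lambda_j|^2\det(I_N+TT^* )^{-2N}$ with respect to Lebesgue measure on all diagonal and strictly upper-triangular complex entries. Conditioning on $\Lambda$ means fixing the diagonal of $T$ (with distinct entries) and renormalizing this density in the strictly upper-triangular entries; $\mathbb{E}_\Lambda$ is the corresponding conditional expectation. *)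

(* Defs.v *)
From HB Require Import structures.
From mathcomp Require Import all_boot all_order all_fingroup all_algebra complex.
From mathcomp Require Import all_classical all_reals all_analysis.

Set Implicit Arguments.
Unset Strict Implicit.
Unset Printing Implicit Defensive.

Import Order.TTheory GRing.Theory Num.Theory.
Import numFieldNormedType.Exports.

Local Open Scope classical_set_scope.
Local Open Scope ring_scope.
Local Open Scope complex_scope.
Local Open Scope sesquilinear_scope.

Section complex_measurable.
Context (R : realType).
Local Notation TR := (measurableTypeR R).

Definition pair_of_complex (z : R[i]) : TR * TR := (complex.Re z, complex.Im z).
Definition complex_of_pair (p : TR * TR) : R[i] := p.1 +i* p.2.

Lemma complex_of_pairK : cancel complex_of_pair pair_of_complex.
Proof. by case. Qed.
Lemma pair_of_complexK : cancel pair_of_complex complex_of_pair.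
Proof. by case. Qed.

Definition complex_sets : set (set R[i]) :=
  preimage_set_system setT pair_of_complex measurable.

Let complex_sigma : sigma_algebra setT complex_sets.
Proof.
exact/sigma_algebra_preimage/sigma_algebra_measurable.
Qed.

HB.instance Definition _ := isPointed.Build R[i] 0.

Let complex_set0 : complex_sets set0.
Proof. by case: complex_sigma. Qed.
Let complex_setC A : complex_sets A -> complex_sets (~` A).
Proof. by case: complex_sigma => _ + _ => /[apply]; rewrite setTD. Qed.
Let complex_bigcup (F : (set R[i])^nat) :
  (forall k, complex_sets (F k)) -> complex_sets (\bigcup_k F k).
Proof. by case: complex_sigma => _ _; apply. Qed.

HB.instance Definition _ := @isMeasurable.Build default_measure_display R[i]
  complex_sets complex_set0 complex_setC complex_bigcup.

Lemma measurable_pair_of_complex : measurable_fun setT pair_of_complex.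
Proof. by move=> _ B mB; exists B. Qed.

Lemma measurable_complex_of_pair : measurable_fun setT complex_of_pair.
Proof.
move=> _ _ [B mB <-]; rewrite !setTI -comp_preimage.
by rewrite (_ : _ \o _ = id) //; apply/funext; exact: complex_of_pairK.
Qed.

End complex_measurable.

Section matrix_measurable.
Context d (T : measurableType d) (m n : nat).

Definition matrix_cylinders : set (set 'M[T]_(m, n)) :=
  [set A | exists i j, exists2 B, measurable B &
           A = (fun M : 'M[T]_(m, n) => M i j) @^-1` B].

Let matrix_set0 : <<s matrix_cylinders >> set0.
Proof. exact: sigma_algebra0. Qed.
Let matrix_setC A : <<s matrix_cylinders >> A -> <<s matrix_cylinders >> (~` A).
Proof. exact: sigma_algebraC. Qed.
Let matrix_bigcup (F : (set 'M[T]_(m, n))^nat) :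
  (forall k, <<s matrix_cylinders >> (F k)) ->
  <<s matrix_cylinders >> (\bigcup_k F k).
Proof. exact: sigma_algebra_bigcup. Qed.

HB.instance Definition _ := @isMeasurable.Build default_measure_display
  'M[T]_(m, n) <<s matrix_cylinders >> matrix_set0 matrix_setC matrix_bigcup.

End matrix_measurable.

Section pushforward_sigma_finite.
Context d1 d2 (T1 : measurableType d1) (T2 : measurableType d2) (R : realType).
Variables (f : T1 -> T2) (g : T2 -> T1).
Hypotheses (mf : measurable_fun setT f) (mg : measurable_fun setT g).
Hypothesis fK : cancel f g.
Variable mu : {sigma_finite_measure set T1 -> \bar R}.

(* The proofs are arguments only to key the measure instances below. *)
Definition iso_pushforward of measurable_fun setT f & measurable_fun setT g
  & cancel f g := pushforward mu f.
Local Notation nu := (iso_pushforward mf mg fK).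

Let nu0 : nu set0 = 0%E.
Proof. by rewrite /iso_pushforward /pushforward preimage_set0 measure0. Qed.
Let nu_ge0 A : (0 <= nu A)%E.
Proof. exact: measure_ge0. Qed.
Let nu_sigma : semi_sigma_additive nu.
Proof.
move=> F mF tF mUF; rewrite /iso_pushforward /pushforward preimage_bigcup.
apply: measure_semi_sigma_additive.
- by move=> k; rewrite -[X in measurable X]setTI; exact: mf.
- apply/trivIsetP => /= i j _ _ ij; rewrite -preimage_setI.
  by move/trivIsetP : tF => /(_ _ _ _ _ ij) ->//; rewrite preimage_set0.
- by rewrite -preimage_bigcup -[X in measurable X]setTI; exact: mf.
Qed.
HB.instance Definition _ := isMeasure.Build _ _ _ nu nu0 nu_ge0 nu_sigma.

Let nu_sigma_finite : sigma_finite setT nu.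
Proof.
have [F TF mF] := sigma_finiteT mu.
exists (fun k => g @^-1` F k); first by rewrite -preimage_bigcup -TF.
move=> k; have [mFk Fkoo] := mF k; split.
  by rewrite -[X in measurable X]setTI; exact: mg.
rewrite /iso_pushforward /pushforward -comp_preimage.
by rewrite (_ : _ \o _ = id) //; apply/funext.
Qed.
HB.instance Definition _ := Measure_isSigmaFinite.Build _ _ _ nu nu_sigma_finite.

Definition sigma_finite_pushforward : {sigma_finite_measure set T2 -> \bar R} :=
  nu.

End pushforward_sigma_finite.

(* The sigma-finite instance declared in lebesgue_integral_fubini is shadowed by
   the one for subprobabilities, so canonical inference on \x does not find it. *)
Section product_sigma_finite.
Context d1 d2 (T1 : measurableType d1) (T2 : measurableType d2) (R : realType).
Variable m1 : {sigma_finite_measure set T1 -> \bar R}.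
Variable m2 : {sigma_finite_measure set T2 -> \bar R}.

Definition product_sigma := (m1 \x m2)%E.
HB.instance Definition _ := Measure.on product_sigma.

Let product_sigma_finite : sigma_finite setT product_sigma.
Proof.
have /sigma_finiteP[F [TF ndF Foo]] := sigma_finiteT m1.
have /sigma_finiteP[G [TG ndG Goo]] := sigma_finiteT m2.
exists (fun n => F n `*` G n).
  rewrite -setXTT TF TG predeqE => -[x y]; split.
    move=> [/= [n _ Fnx] [k _ Gky]]; exists (maxn n k) => //; split.
    - by move: x Fnx; exact/subsetPset/ndF/leq_maxl.
    - by move: y Gky; exact/subsetPset/ndG/leq_maxr.
  by move=> [n _ []/= ? ?]; split; exists n.
move=> k; have [? ?] := Foo k; have [? ?] := Goo k.
split; first exact: measurableX.
by rewrite /product_sigma product_measure1E// lte_mul_pinfty// ge0_fin_numE.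
Qed.
HB.instance Definition _ :=
  Measure_isSigmaFinite.Build _ _ _ product_sigma product_sigma_finite.

Definition product_sigma_finite_measure :
  {sigma_finite_measure set (T1 * T2)%type -> \bar R} := product_sigma.

End product_sigma_finite.

Section lebesgue_Cn.
Context (R : realType).

Definition lebesgue_complex : {sigma_finite_measure set R[i] -> \bar R} :=
  sigma_finite_pushforward (@measurable_complex_of_pair R)
    (@measurable_pair_of_complex R) (@complex_of_pairK R)
    (product_sigma_finite_measure (@lebesgue_measure R) (@lebesgue_measure R)).

Definition tcons n (p : R[i] * n.-tuple R[i]) : n.+1.-tuple R[i] :=
  [tuple of p.1 :: p.2].
Definition tuncons n (t : n.+1.-tuple R[i]) : R[i] * n.-tuple R[i] :=
  (thead t, [tuple of behead t]).

Lemma tconsK n : cancel (@tcons n) (@tuncons n).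
Proof. by case=> x t; congr pair; apply: val_inj. Qed.

Lemma measurable_tcons n : measurable_fun setT (@tcons n).
Proof. exact: measurable_cons. Qed.

Lemma measurable_tuncons n : measurable_fun setT (@tuncons n).
Proof.
apply/measurable_fun_pairP; split.
  exact: measurable_tnth.
exact: measurable_behead.
Qed.

Fixpoint lebesgue_Cn n : {sigma_finite_measure set (n.-tuple R[i]) -> \bar R} :=
  match n with
  | 0 => \d_([tuple] : 0.-tuple R[i])
  | n'.+1 => sigma_finite_pushforward (@measurable_tcons n')
      (@measurable_tuncons n') (@tconsK n') 
        (product_sigma_finite_measure lebesgue_complex (lebesgue_Cn n'))
  end.

End lebesgue_Cn.

Section random_matrices.
Context (R : realType).
Local Notation C := R[i].

(* Law of a centered circular complex Gaussian: independent real and imaginary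
   parts, each of mean 0 and standard deviation sigma. *)
Definition complex_normal (sigma : R) : set C -> \bar R :=
  pushforward (normal_prob 0 sigma \x normal_prob 0 sigma)%E
    (@complex_of_pair R).

Definition iid d (Omega : measurableType d) (P : probability Omega R)
    (I : finType) (X : I -> Omega -> C) (mu : set C -> \bar R) :=
  forall B : I -> set C, (forall k, measurable (B k)) ->
    P (\bigcap_k (X k @^-1` B k)) = (\prod_k fine (mu (B k)))%:E.

(* G1 and G2 are independent and both have i.i.d. entries exactly when all the
   entries of the two matrices together form one i.i.d. family. *)
Definition ginibre_pair d (Omega : measurableType d) (P : probability Omega R)
    N (G1 G2 : Omega -> 'M[C]_N) :=
  exists2 sigma : R, 0 < sigma &
    iid P (fun (k : bool * ('I_N * 'I_N)) (w : Omega) =>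
             (if k.1 then G1 w else G2 w) k.2.1 k.2.2)
        (complex_normal sigma).

(* invmx G2 is only meaningful off the null event that G2 is singular. *)
Definition spherical_ensemble N (mu : set 'M[C]_N -> \bar R) :=
  exists d (Omega : measurableType d) (P : probability Omega R)
    (G1 G2 : {RV P >-> 'M[C]_N}),
    ginibre_pair P G1 G2 /\
    forall A : set 'M[C]_N, measurable A ->
      mu A = P [set w | A (G1 w *m invmx (G2 w))].

Definition exchangeable_spectrum d (Omega : measurableType d)
    (P : probability Omega R) N (G : Omega -> 'M[C]_N)
    (Lam : Omega -> N.-tuple C) :=
  (forall w, char_poly (G w) = \prod_(z <- Lam w) ('X - z%:P)) /\
  (forall (s : 'S_N) (A : set (N.-tuple C)), measurable A ->
     P [set w | A [tuple tnth (Lam w) (s i) | i < N]] = P (Lam @^-1` A)).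

Definition strict_upper_positions N : seq ('I_N * 'I_N) :=
  [seq p : 'I_N * 'I_N <- enum {: 'I_N * 'I_N} | (p.1 < p.2)%N].

Definition upper_dim N := size (strict_upper_positions N).

(* The upper triangular matrix with diagonal lam whose entry at the k-th
   strictly upper position is the k-th component of t. *)
Definition upper_mx N (lam : N.-tuple C) (t : (upper_dim N).-tuple C) : 'M[C]_N :=
  \matrix_(i, j) if i == j then tnth lam i
    else if (i < j)%N then nth 0 t (index (i, j) (strict_upper_positions N))
    else 0.

(* The determinant is that of a Hermitian matrix, hence real. *)
Definition schur_density N (M : 'M[C]_N) : R :=
  (\prod_(i < N) \prod_(j < N | (i < j)%N)
     ComplexField.Normc.normc (M i i - M j j) ^+ 2)
  * complex.Re (\det (1%:M + M *m M^t*)) ^- (2 * N)%N.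

Record schur_form d (Omega : measurableType d) (P : probability Omega R) N
    (G : Omega -> 'M[C]_N) (Lam : Omega -> N.-tuple C)
    (U T : Omega -> 'M[C]_N) : Prop := SchurForm {
  schur_unitary : forall w, U w \is unitarymx ;
  schur_eq : forall w, G w = U w *m T w *m (U w)^t* ;
  schur_diag : forall w i, T w i i = tnth (Lam w) i ;
  schur_lower : forall w (i j : 'I_N), (j < i)%N -> T w i j = 0 ;
  schur_law : exists2 c : R, 0 < c &
    forall A : set 'M[C]_N, measurable A ->
      P (T @^-1` A) =
      (c%:E * \int[lebesgue_Cn R N \x lebesgue_Cn R (upper_dim N)]_p
        (\1_A (upper_mx p.1 p.2) * schur_density (upper_mx p.1 p.2))%:E)%E }.

(* The conditional expectation of f given that the diagonal of the Schur form is
   lam: the density of T at fixed diagonal is renormalized over the strictly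
   upper triangular entries. Nonnegative f may have infinite expectation. *)
Definition schur_condE N (lam : N.-tuple C) (f : 'M[C]_N -> R) : \bar R :=
  (\int[lebesgue_Cn R (upper_dim N)]_t
     (f (upper_mx lam t) * schur_density (upper_mx lam t))%:E
   / \int[lebesgue_Cn R (upper_dim N)]_t (schur_density (upper_mx lam t))%:E)%E.

(* h(Y) is a version of the conditional expectation of the nonnegative random
   variable X given Y. Integrability of X is not required: for N = 1 already,
   Tr G^* G has infinite mean. *)
Definition is_condE d d' (Omega : measurableType d) (E : measurableType d')
    (P : probability Omega R) (X : Omega -> R) (Y : Omega -> E) (h : E -> R) :=
  measurable_fun setT h /\
  forall B : set E, measurable B ->
    (\int[P]_(w in Y @^-1` B) (X w)%:E = \int[P]_(w in Y @^-1` B) (h (Y w))%:E)%E.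

Definition normalized_trace_sq N (M : 'M[C]_N) : R :=
  N%:R^-1 * complex.Re (\tr (M^t* *m M)).

End random_matrices.

(* Main.v *)
(* The strictly upper positions are listed row by row, so peel off the first row
   of T = [x, u; 0, B].  With c = 1 + |x|^2 and V = (1 + B^* B)^-1,
     det (1 + T T^* ) = det (1 + B B^* ) (c + u V u^* ),
   and det V = det (1 + B B^* )^-1.  Integrating a power -p of c + u V u^* over
   the row u in C^n gives a constant times c^(n-p) / det V: the weight of T with
   exponent n + 1 + N becomes the weight of B with exponent n + N.  The mean of
   u u^* under this density is c tr (V^-1) / N = c (n + tr (B^* B)) / N, so the
   means S_n of tr (T^* T) satisfy
     S_(n+1) + n + 1 + N = (1 + c / N) (S_n + n + N),
   whence the product formula.  The integral over u is computed one coordinate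
   at a time by completing the square. *)

Require Import Defs.
From HB Require Import structures.
From mathcomp Require Import all_boot all_order all_fingroup all_algebra complex.
From mathcomp Require Import all_classical all_reals all_analysis.
From mathcomp Require Import measurable_realfun ring lra.

Set Implicit Arguments.
Unset Strict Implicit.
Unset Printing Implicit Defensive.

Import Order.TTheory GRing.Theory Num.Theory.
Import numFieldNormedType.Exports.

Local Open Scope classical_set_scope.
Local Open Scope ring_scope.
Local Open Scope complex_scope.
Local Open Scope sesquilinear_scope.

(** * Lebesgue integration on R and C *)

Section real_line.
Context {R : realType}.
Local Notation mu := (@lebesgue_measure R).
Local Notation TR := (measurableTypeR R).

Lemma measurable_affine (a b : R) :
  measurable_fun setT ((fun x => a * x + b) : TR -> TR).
Proof. by apply: measurable_funD => //; exact: measurable_funM. Qed.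

Lemma lebesgue_measure_affine (a b : R) (a0 : 0 < a) (A : set TR) :
  measurable A ->
  (mu ((fun x => a * x + b)%R @^-1` A) = (a^-1)%:E * mu A)%E.
Proof.
move=> mA; have a0' : (0 <= a)%R by exact: ltW.
pose phi := (fun x => a * x + b) : TR -> TR.
pose mphi_mixin := isMeasurableFun.Build _ _ _ _ _ (measurable_affine a b).
pose phi' : {mfun _ >-> _} := HB.pack phi mphi_mixin.
rewrite (@lebesgue_measure_unique R (mscale (NngNum a0') (pushforward mu phi'))
  _ A mA); last first.
  move=> _ [[c d]] _ <-.
  transitivity (a%:E * mu (phi @^-1` `]c, d]%classic))%E; last by [].
  rewrite (_ : phi @^-1` _ = `](c - b) / a, (d - b) / a]%classic); last first.
    apply/seteqP; split=> x /=; rewrite !in_itv/= /phi ler_pdivlMr// ltr_pdivrMr//.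
      by rewrite ltrBlDr lerBrDr (mulrC x).
    by rewrite ltrBlDr lerBrDr (mulrC x).
  rewrite !lebesgue_measure_itv/= !lte_fin ltr_pM2r ?invr_gt0// ltrD2r.
  case: ifPn => _; last by rewrite mule0.
  by rewrite -!EFinB -EFinM; congr EFin; field; rewrite gt_eqF.
transitivity (a^-1%:E * (a%:E * mu (phi @^-1` A)))%E; last by [].
by rewrite muleA -EFinM mulVf ?gt_eqF// mul1e.
Qed.

Lemma ge0_integral_affine (a b : R) (f : TR -> \bar R) : 0 < a ->
  measurable_fun setT f -> (forall x, 0 <= f x)%E ->
  (\int[mu]_x f (a * x + b)%R = (a^-1)%:E * \int[mu]_x f x)%E.
Proof.
move=> a0 mf f0.
have := @ge0_integral_pushforward _ _ _ _ R _ (measurable_affine a b) mu setT f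
  measurableT mf (fun x _ => f0 x).
rewrite /= preimage_setT => <-.
have a0' : (0 <= a^-1)%R by rewrite invr_ge0 ltW.
have := @ge0_integral_mscale _ _ R mu setT measurableT (NngNum a0') f
  mf (fun x _ => f0 x).
rewrite /= => <-.
apply: eq_measure_integral => [|mab A mA _]; first exact: measurable_affine.
transitivity (mu ((fun x => a * x + b)%R @^-1` A)); first by [].
by rewrite lebesgue_measure_affine.
Qed.

Lemma ge0_integral_opp (f : TR -> \bar R) :
  measurable_fun setT f -> (forall x, 0 <= f x)%E ->
  (\int[mu]_x f (- x)%R = \int[mu]_x f x)%E.
Proof.
move=> mf f0.
have mN : measurable_fun setT (-%R : TR -> TR) by exact: measurable_funN.
have := @ge0_integral_pushforward _ _ _ _ R _ mN mu setT f
  measurableT mf (fun x _ => f0 x).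
rewrite /= preimage_setT => <-.
by apply: eq_measure_integral => //= A mA _; exact: lebesgue_measureN.
Qed.
End real_line.

Section complex_plane.
Context {R : realType}.
Local Notation mu := (@lebesgue_measure R).
Local Notation muC := (lebesgue_complex R).
Local Notation TR := (measurableTypeR R).
Local Notation C := R[i].

Lemma ge0_integral_sigma_finite_pushforward d1 d2 (T1 : measurableType d1)
    (T2 : measurableType d2) (f : T1 -> T2) (g : T2 -> T1)
    (mf : measurable_fun setT f) (mg : measurable_fun setT g) (fK : cancel f g)
    (m : {sigma_finite_measure set T1 -> \bar R}) (h : T2 -> \bar R) :
  measurable_fun setT h -> (forall x, 0 <= h x)%E ->
  (\int[sigma_finite_pushforward mf mg fK m]_x h x = \int[m]_x h (f x))%E.
Proof.
move=> mh h0.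
have := @ge0_integral_pushforward _ _ _ _ R f mf m setT h
  measurableT mh (fun x _ => h0 x).
rewrite preimage_setT => <-.
by apply: eq_measure_integral => //= mf' A mA _.
Qed.

Lemma ge0_integral_product_sigma d1 d2 (T1 : measurableType d1)
    (T2 : measurableType d2)
    (m1 : {sigma_finite_measure set T1 -> \bar R})
    (m2 : {sigma_finite_measure set T2 -> \bar R}) (h : T1 * T2 -> \bar R) :
  measurable_fun setT h -> (forall x, 0 <= h x)%E ->
  (\int[product_sigma_finite_measure m1 m2]_x h x =
   \int[m1]_x \int[m2]_y h (x, y))%E.
Proof.
move=> mh h0; rewrite -(fubini_tonelli1 h)//.

Qed.

Lemma ge0_integral_complexE (f : C -> \bar R) :
  measurable_fun setT f -> (forall x, 0 <= f x)%E ->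
  (\int[muC]_z f z = \int[mu]_x \int[mu]_y f (x +i* y)%C)%E.
Proof.
move=> mf f0.
rewrite ge0_integral_sigma_finite_pushforward// ge0_integral_product_sigma//.
  by apply: (measurableT_comp mf); exact: measurable_complex_of_pair.
Qed.

Lemma measurable_complexP d (T : measurableType d) (f : T -> C) :
  measurable_fun setT (fun t => complex.Re (f t) : TR) ->
  measurable_fun setT (fun t => complex.Im (f t) : TR) ->
  measurable_fun setT f.
Proof.
move=> mr mi.
rewrite (_ : f = @complex_of_pair R \o
    (fun t => (complex.Re (f t), complex.Im (f t)) : TR * TR)).
  apply: measurableT_comp; first exact: measurable_complex_of_pair.
  exact: measurable_fun_pair.
by apply/funext => t /=; rewrite /complex_of_pair/=; case: (f t).
Qed.

Lemma measurable_Re : measurable_fun setT (@complex.Re R : C -> TR).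
Proof.
rewrite (_ : @complex.Re R = fst \o @pair_of_complex R)//.
by apply: measurableT_comp => //; exact: measurable_pair_of_complex.
Qed.

Lemma measurable_Im : measurable_fun setT (@complex.Im R : C -> TR).
Proof.
rewrite (_ : @complex.Im R = snd \o @pair_of_complex R)//.
by apply: measurableT_comp => //; exact: measurable_pair_of_complex.
Qed.

End complex_plane.

Section measurable_complex.
Context {R : realType} d (T : measurableType d).
Local Notation C := R[i].
Implicit Types f g : T -> C.

Lemma measurable_complexRe f : measurable_fun setT f ->
  measurable_fun setT (fun t => complex.Re (f t)).
Proof. by move=> mf; apply: (measurableT_comp (@measurable_Re R)). Qed.

Lemma measurable_complexIm f : measurable_fun setT f ->
  measurable_fun setT (fun t => complex.Im (f t)).
Proof. by move=> mf; apply: (measurableT_comp (@measurable_Im R)). Qed.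

Lemma measurable_complexD f g : measurable_fun setT f -> measurable_fun setT g ->
  measurable_fun setT (fun t => f t + g t).
Proof.
move=> mf mg; apply: measurable_complexP.
  rewrite (_ : (fun _ => _) = (fun t => complex.Re (f t) + complex.Re (g t))); last first.
    by apply/funext => t; case: (f t) (g t) => ? ? [].
  by apply: measurable_funD; exact: measurable_complexRe.
rewrite (_ : (fun _ => _) = (fun t => complex.Im (f t) + complex.Im (g t))); last first.
  by apply/funext => t; case: (f t) (g t) => ? ? [].
by apply: measurable_funD; exact: measurable_complexIm.
Qed.

Lemma measurable_complexM f g : measurable_fun setT f -> measurable_fun setT g ->
  measurable_fun setT (fun t => f t * g t).
Proof.
move=> mf mg.
have mfr := measurable_complexRe mf; have mfi := measurable_complexIm mf.
have mgr := measurable_complexRe mg; have mgi := measurable_complexIm mg.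
apply: measurable_complexP.
  rewrite (_ : (fun _ => _) = (fun t => complex.Re (f t) * complex.Re (g t)
      - complex.Im (f t) * complex.Im (g t))); last first.
    by apply/funext => t; case: (f t) (g t) => ? ? [].
  by apply: measurable_funB; exact: measurable_funM.
rewrite (_ : (fun _ => _) = (fun t => complex.Re (f t) * complex.Im (g t)
    + complex.Im (f t) * complex.Re (g t))); last first.
  by apply/funext => t; case: (f t) (g t) => ? ? [].
by apply: measurable_funD; exact: measurable_funM.
Qed.

Lemma measurable_complexN f : measurable_fun setT f ->
  measurable_fun setT (fun t => - f t).
Proof.
move=> mf; under eq_fun do rewrite -mulN1r.
by apply: measurable_complexM => //; exact: measurable_cst.
Qed.

Lemma measurable_complex_conj f : measurable_fun setT f ->
  measurable_fun setT (fun t => (f t)^*%R).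
Proof.
move=> mf; apply: measurable_complexP.
  rewrite (_ : (fun _ => _) = (fun t => complex.Re (f t))); last first.
    by apply/funext => t; case: (f t).
  exact: measurable_complexRe.
rewrite (_ : (fun _ => _) = (fun t => - complex.Im (f t))); last first.
  by apply/funext => t; case: (f t).
by apply: measurable_funN; exact: measurable_complexIm.
Qed.

Lemma measurable_complex_sum (I : Type) (s : seq I) (P : pred I) (F : I -> T -> C) :
  (forall i, measurable_fun setT (F i)) ->
  measurable_fun setT (fun t => \sum_(i <- s | P i) F i t).
Proof.
move=> mF; elim: s => [|i s IH].
  by under eq_fun do rewrite big_nil; exact: measurable_cst.
under eq_fun do rewrite big_cons.
by case: (P i) => //; exact: measurable_complexD.
Qed.

Lemma measurable_complex_prod (I : Type) (s : seq I) (P : pred I) (F : I -> T -> C) :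
  (forall i, measurable_fun setT (F i)) ->
  measurable_fun setT (fun t => \prod_(i <- s | P i) F i t).
Proof.
move=> mF; elim: s => [|i s IH].
  by under eq_fun do rewrite big_nil; exact: measurable_cst.
under eq_fun do rewrite big_cons.
by case: (P i) => //; exact: measurable_complexM.
Qed.

Definition measurable_mx m n (F : T -> 'M[C]_(m, n)) :=
  forall i j, measurable_fun setT (fun t => F t i j).

Lemma measurable_mx_cst m n (A : 'M[C]_(m, n)) : measurable_mx (fun=> A).
Proof. by move=> i j; exact: measurable_cst. Qed.

Lemma measurable_mxD m n (F G : T -> 'M[C]_(m, n)) :
  measurable_mx F -> measurable_mx G -> measurable_mx (fun t => F t + G t).
Proof.
move=> mF mG i j; under eq_fun do rewrite mxE; exact: measurable_complexD.
Qed.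

Lemma measurable_mxM m n p (F : T -> 'M[C]_(m, n)) (G : T -> 'M[C]_(n, p)) :
  measurable_mx F -> measurable_mx G -> measurable_mx (fun t => F t *m G t).
Proof.
move=> mF mG i j; under eq_fun do rewrite mxE.
by apply: measurable_complex_sum => k; exact: measurable_complexM.
Qed.

Lemma measurable_mx_adj m n (F : T -> 'M[C]_(m, n)) :
  measurable_mx F -> measurable_mx (fun t => (F t)^t* )%sesqui.
Proof.
move=> mF i j; under eq_fun do rewrite !mxE.
exact: measurable_complex_conj.
Qed.

Lemma measurable_mx_det n (F : T -> 'M[C]_n) :
  measurable_mx F -> measurable_fun setT (fun t => \det (F t)).
Proof.
move=> mF; rewrite /determinant; apply: measurable_complex_sum => s.
apply: measurable_complexM; first exact: measurable_cst.
exact: measurable_complex_prod.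
Qed.

Lemma measurable_mx_trace n (F : T -> 'M[C]_n) :
  measurable_mx F -> measurable_fun setT (fun t => \tr (F t)).
Proof. by move=> mF; apply: measurable_complex_sum. Qed.

End measurable_complex.

Section complex_change_of_variables.
Context {R : realType}.
Local Notation mu := (@lebesgue_measure R).
Local Notation muC := (lebesgue_complex R).
Local Notation C := R[i].

Lemma ge0_integral_complex_affine (a : R) (b : C) (f : C -> \bar R) : 0 < a ->
  measurable_fun setT f -> (forall x, 0 <= f x)%E ->
  (\int[muC]_z f (a%:C * z + b)%R = (a ^- 2)%:E * \int[muC]_z f z)%E.
Proof.
move=> a0 mf f0.
have mphi : measurable_fun setT (fun z => a%:C * z + b : C).
  by apply: measurable_complexD => //; exact: measurable_complexM.
rewrite !ge0_integral_complexE//; last exact: measurableT_comp.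
case: b mphi => b1 b2 mphi.
have mf2 : measurable_fun setT (f \o @complex_of_pair R).
  by apply: (measurableT_comp mf); exact: measurable_complex_of_pair.
under eq_integral => x _.
  under eq_integral => y _.
    rewrite (_ : (a%:C * (x +i* y) + (b1 +i* b2))%R = (a * x + b1) +i* (a * y + b2)); last first.
      by simpc.
    over.
  rewrite (ge0_integral_affine b2 (f := fun y => f ((a * x + b1) +i* y)))//; last first.
    exact: (measurableT_comp mf2 (pair1_measurable _)).
  over.
rewrite /= ge0_integralZl//; last 3 first.
- have := measurable_fun_fubini_tonelli_F (m2 := mu) _ mf2 (fun x => f0 _).
  by move=> H; apply: (measurableT_comp H (measurable_affine a b1)).
- by move=> x _; exact: integral_ge0.
- by rewrite lee_fin invr_ge0 ltW.
rewrite (ge0_integral_affine b1 (f := fun x => (\int[mu]_y f (x +i* y))%E))//; last 2 first.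
- exact: (measurable_fun_fubini_tonelli_F (m2 := mu) _ mf2 (fun x => f0 _)).
- by move=> x; exact: integral_ge0.
by rewrite muleA -EFinM -expr2 exprVn.
Qed.

Lemma ge0_integral_complex_opp (f : C -> \bar R) :
  measurable_fun setT f -> (forall x, 0 <= f x)%E ->
  (\int[muC]_z f (- z)%R = \int[muC]_z f z)%E.
Proof.
move=> mf f0.
have mphi : measurable_fun setT (fun z : C => - z : C).
  exact: measurable_complexN.
rewrite !ge0_integral_complexE//; last exact: measurableT_comp.
have mf2 : measurable_fun setT (f \o @complex_of_pair R).
  by apply: (measurableT_comp mf); exact: measurable_complex_of_pair.
under eq_integral => x _.
  under eq_integral => y _.
    rewrite (_ : (- (x +i* y))%R = (- x) +i* (- y)); last by simpc.
    over.
  rewrite (ge0_integral_opp (f := fun y => f ((- x) +i* y)))//; last first.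
    exact: (measurableT_comp mf2 (pair1_measurable _)).
  over.
rewrite (ge0_integral_opp (f := fun x => (\int[mu]_y f (x +i* y))%E))//; last first.
- by move=> x; exact: integral_ge0.
- exact: (measurable_fun_fubini_tonelli_F (m2 := mu) _ mf2 (fun x => f0 _)).
Qed.

End complex_change_of_variables.

(** * Integrals of a shifted quadratic to a negative power on C *)

Section power_integrals.
Context {R : realType}.
Local Notation mu := (@lebesgue_measure R).
Local Notation muC := (lebesgue_complex R).
Local Notation TR := (measurableTypeR R).
Local Notation C := R[i].

Lemma measurable_inv : measurable_fun setT (GRing.inv : TR -> TR).
Proof.
rewrite -(setUv [set 0 : R]); apply/measurable_funU => //.
  exact: measurableC.
split; first exact: measurable_fun_set1.
apply: open_continuous_measurable_fun.
  rewrite (_ : ~` _ = [set x | x != 0]); first exact: open_neq.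
  by apply/seteqP; split => x /= /eqP.
by move=> x; rewrite inE => /eqP x0; exact: inv_continuous.
Qed.

Lemma measurable_funV d (T : measurableType d) (f : T -> R) :
  measurable_fun setT f -> measurable_fun setT (fun x => (f x)^-1).
Proof. by move=> mf; apply: (measurableT_comp measurable_inv). Qed.

Lemma is_derive_oneDXV (n : nat) (x : R) : 0 <= x ->
  is_derive x 1 (fun y : R => (1 + y) ^- n) (- n%:R * (1 + x) ^- n.+1).
Proof.
move=> x0.
have x1 : 1 + x != 0 by rewrite gt_eqF// ltr_pwDl.
have h : is_derive x 1 ((fun y : R => 1 + y) ^+ n) ((n%:R * (1 + x) ^+ n.-1) *: (1:R)).
  apply: is_deriveX.
  have := is_deriveD (is_derive_cst (1:R) x 1) (is_derive_id x (1:R)).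
  by rewrite add0r.
have := @is_deriveV R _ x _ 1 _ h.
rewrite fctE expf_neq0// => /(_ isT).
suff -> : - ((1 + x) ^+ n) ^- 2 *: (n%:R * (1 + x) ^+ n.-1 *: (1:R)) = - n%:R * (1 + x) ^- n.+1.
  by [].
change (- ((1 + x) ^+ n) ^- 2 * (n%:R * (1 + x) ^+ n.-1 * 1) = - n%:R * (1 + x) ^- n.+1).
case: n h => [|n] h; first by rewrite /= oppr0 !mul0r mulr0.
by rewrite /= -[X in X ^- 2]/((1 + x) ^+ n.+1) !exprS; field; rewrite x1 expf_neq0.
Qed.

Lemma cvgy_oneDXV (n : nat) : (0 < n)%N -> (1 + x) ^- n @[x --> +oo%R] --> (0 : R).
Proof.
move=> n0.
have h : (1 + x)^-1 @[x --> +oo%R] --> (0 : R).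
  apply/gtr0_cvgV0.
    by near=> x; rewrite ltr_pwDl//; near: x; apply: nbhs_pinfty_ge; exact: num_real.
  apply/cvgryPgt => A; near=> x; rewrite -ltrBlDl; near: x.
  apply: nbhs_pinfty_gt; exact: num_real.
under eq_fun do rewrite -exprVn.
have := continuous_cvg _ (@exprn_continuous R n 0) h.
by rewrite expr0n gtn_eqF//; apply.
Unshelve. all: by end_near. Qed.

Lemma continuous_oneDXV (n : nat) (x : R) : 0 <= x ->
  {for x, continuous (fun y : R => (1 + y) ^- n)}.
Proof.
move=> x0; have [h _] := is_derive_oneDXV n x0.
exact/differentiable_continuous/derivable1_diffP.
Qed.

Lemma integral_oneDXV_tail (n : nat) (r : R) : 0 <= r ->
  (\int[mu]_(s in `]r, +oo[) (n.+1%:R * (1 + s) ^- n.+2)%:E =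
   ((1 + r) ^- n.+1)%:E)%E.
Proof.
move=> r0.
have cf (x : R) : 0 <= x -> {for x, continuous (fun y : R => n.+1%:R * (1 + y) ^- n.+2)}.
  by move=> x0; apply: cvgMr; exact: continuous_oneDXV.
rewrite integral_itv_obnd_cbnd; last first.
  apply/measurable_EFinP/measurable_funTS; apply: measurable_funM => //.
  by apply: measurable_funV; apply: measurable_funX; exact: measurable_funD.
rewrite (@ge0_continuous_FTC2y _ _ (fun s => - (1 + s) ^- n.+1) r 0).
- by rewrite -EFinB sub0r opprK.
- move=> x rx; rewrite mulr_ge0// invr_ge0 exprn_ge0// addr_ge0//; exact: le_trans rx.
- apply/continuous_within_itvcyP; split.
    move=> x; rewrite in_itv/= andbT => rx; apply: cf; apply: ltW; exact: le_lt_trans rx.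
  by apply: cvg_at_right_filter; exact: cf.
- by rewrite -oppr0; apply: cvgN; exact: cvgy_oneDXV.
- move=> x rx; have [h _] := is_derive_oneDXV n.+1 (ltW (le_lt_trans r0 rx)).
  exact: derivableN.
- apply: cvgN; apply: cvg_at_right_filter; exact: continuous_oneDXV.
- move=> x; rewrite in_itv/= andbT => rx.
  have h := is_derive_oneDXV n.+1 (ltW (le_lt_trans r0 rx)).
  rewrite derive1E deriveN; last by case: h.
  by rewrite (@derive_val _ _ _ _ _ _ _ h) mulNr opprK.
Qed.

Lemma integral_idM_oneDXV (n : nat) : (0 < n)%N ->
  (\int[mu]_(s in `]0%R, +oo[) (s * (n.+1%:R * (1 + s) ^- n.+2))%:E =
   (n%:R^-1)%:E)%E.
Proof.
move=> n0.
have cf (x : R) : 0 <= x -> {for x, continuous (fun y : R => y * (n.+1%:R * (1 + y) ^- n.+2))}.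
  by move=> x0; apply: cvgM; [exact: cvg_id|apply: cvgMr; exact: continuous_oneDXV].
rewrite integral_itv_obnd_cbnd; last first.
  apply/measurable_EFinP/measurable_funTS; apply: measurable_funM => //.
  apply: measurable_funM => //.
  by apply: measurable_funV; apply: measurable_funX; exact: measurable_funD.
pose F (s : R) := (1 + s) ^- n.+1 - (n.+1%:R / n%:R) * (1 + s) ^- n.
have dF (x : R) : 0 <= x -> is_derive x 1 F (x * (n.+1%:R * (1 + x) ^- n.+2)).
  move=> x0.
  have h1 := is_derive_oneDXV n.+1 x0.
  have h2 := is_derive_oneDXV n x0.
  have := is_deriveB h1 (is_deriveZ (n.+1%:R / n%:R) h2).
  suff -> : - n.+1%:R * (1 + x) ^- n.+2 -
      (n.+1%:R / n%:R) *: (- n%:R * (1 + x) ^- n.+1) =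
      x * (n.+1%:R * (1 + x) ^- n.+2) by [].
  rewrite /GRing.scale/=.
  have x1 : 1 + x != 0 by rewrite gt_eqF// ltr_pwDl.
  by rewrite !exprS; field; rewrite x1 expf_neq0//= pnatr_eq0 -lt0n.
rewrite (@ge0_continuous_FTC2y _ _ F 0 0).
- rewrite /F addr0 !expr1n !invr1 mulr1 -EFinB; congr EFin.
  by rewrite -natr1; field; rewrite pnatr_eq0 -lt0n.
- by move=> x x0; rewrite !mulr_ge0// invr_ge0 exprn_ge0// addr_ge0.
- apply/continuous_within_itvcyP; split.
    by move=> x; rewrite in_itv/= andbT => rx; apply: cf; exact: ltW.
  by apply: cvg_at_right_filter; exact: cf.
- rewrite -[X in _ --> X](subr0 (0:R)) -[X in _ --> _ - X](mulr0 (n.+1%:R / n%:R)).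
  by apply: cvgB; [|apply: cvgMr]; exact: cvgy_oneDXV.
- by move=> x rx; have [] := dF x (ltW rx).
- apply: cvg_at_right_filter; have [h _] := dF 0 (lexx 0).
  exact/differentiable_continuous/derivable1_diffP.
- move=> x; rewrite in_itv/= andbT => rx.
  by rewrite derive1E (@derive_val _ _ _ _ _ _ _ (dF x (ltW rx))).
Qed.
End power_integrals.

Section unit_disc.
Context {R : realType}.
Local Notation mu := (@lebesgue_measure R).
Local Notation muC := (lebesgue_complex R).
Local Notation TR := (measurableTypeR R).
Local Notation C := R[i].

Definition nsq (z : C) : R := complex.Re z ^+ 2 + complex.Im z ^+ 2.

Lemma nsq_ge0 z : 0 <= nsq z.
Proof. by rewrite addr_ge0// sqr_ge0. Qed.

Lemma nsqZ (a : R) z : nsq (a%:C * z) = a ^+ 2 * nsq z.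
Proof. by case: z => x y; rewrite /nsq /=; ring. Qed.

Lemma measurable_nsq : measurable_fun setT (nsq : C -> R).
Proof.
apply: measurable_funD; apply: measurable_funX.
  exact: measurable_Re.
exact: measurable_Im.
Qed.

Definition unit_disc_area : R := fine (muC [set z | nsq z < 1]).

Lemma measurable_disc (s : R) : measurable [set z : C | nsq z < s].
Proof.
have := measurable_fun_ltr measurable_nsq (measurable_cst s).
move=> /(_ measurableT [set true]); rewrite setTI => h.
by have := h I; congr measurable; apply/seteqP; split.
Qed.

Lemma integral_disc (s : R) :
  (\int[muC]_z (\1_[set z : C | nsq z < s] z)%:E = muC [set z | (nsq z < s)%R])%E.
Proof. by rewrite integral_indic ?setIT//; exact: measurable_disc. Qed.

Lemma lebesgue_complexE (A : set C) : 
   muC A = (mu \x mu)%E (@complex_of_pair R @^-1` A).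
Proof. by []. Qed.

Lemma unit_disc_area_bounds :
  muC [set z | nsq z < 1] = unit_disc_area%:E /\ 0 < unit_disc_area.
Proof.
pose D := @complex_of_pair R @^-1` [set z | nsq z < 1].
have mD : measurable D.
  rewrite -[D]setTI; apply: measurable_complex_of_pair => //; exact: measurable_disc.
have ub : ((mu \x mu)%E D <= 4%:E)%E.
  pose S : set (TR * TR) := `[-1 : R, 1]%classic `*` `[-1 : R, 1]%classic.
  have mS : measurable S by apply: measurableX; exact: measurable_itv.
  have -> : (4%:E = (mu \x mu)%E S)%E.
    rewrite product_measure1E//= !lebesgue_measure_itv/= lte_fin ifT; last lra.
    by rewrite -EFinB -EFinM; congr EFin; lra.
  apply: le_measure; rewrite ?inE// => -[x y]; rewrite /D /S /nsq /= => xy1.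
  by rewrite !in_itv/=; split; apply/andP; split; nra.
have lb : ((4^-1)%:E <= (mu \x mu)%E D)%E.
  pose S : set (TR * TR) := `[0 : R, 2^-1]%classic `*` `[0 : R, 2^-1]%classic.
  have mS : measurable S by apply: measurableX; exact: measurable_itv.
  have -> : ((4^-1)%:E = (mu \x mu)%E S)%E.
    rewrite product_measure1E//= !lebesgue_measure_itv/= lte_fin ifT; last lra.
    by rewrite -EFinB -EFinM; congr EFin; lra.
  apply: le_measure; rewrite ?inE// => -[x y]; rewrite /D /S /nsq /= !in_itv/=.
  by move=> [/andP[x0 x1] /andP[y0 y1]]; nra.
have E : muC [set z | nsq z < 1] = unit_disc_area%:E.
  rewrite /unit_disc_area fineK// ge0_fin_numE ?measure_ge0//.
  by rewrite lebesgue_complexE (le_lt_trans ub)// ltry.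
split=> //; rewrite -lte_fin -E lebesgue_complexE (lt_le_trans _ lb)//.
by rewrite lte_fin invr_gt0.
Qed.

Lemma disc_area (s : R) : 0 < s ->
  muC [set z | nsq z < s] = (s * unit_disc_area)%:E.
Proof.
move=> s0.
have q0 : 0 < Num.sqrt s by rewrite sqrtr_gt0.
have [E _] := unit_disc_area_bounds.
have mi : measurable_fun setT (fun z : C => (\1_[set z : C | nsq z < s] z : R)%:E).
  by apply/measurable_EFinP; apply: measurable_indic; exact: measurable_disc.
have := ge0_integral_complex_affine 0 q0 mi.
rewrite (integral_disc s).
under eq_integral => z _.
  rewrite addr0 (_ : \1_ _ _ = \1_[set z : C | nsq z < 1] z); last first.
    rewrite !indicE; congr ((nat_of_bool _)%:R).
    apply/idP/idP; rewrite !inE/= nsqZ sqr_sqrtr ?ltW//.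
      by move=> h; rewrite -(ltr_pM2l s0) mulr1.
    by move=> h; rewrite -[X in _ < X]mulr1 ltr_pM2l.
  over.
rewrite (integral_disc 1).
rewrite E sqr_sqrtr ?ltW// => /(_ _)/(congr1 (fun x => s%:E * x)%E).
rewrite muleA -!EFinM mulfV ?gt_eqF// mul1e => ->//.
Qed.

(* Layer cake: [(1 + r)^-(n+1)] is the integral over [s > r] of
   [(n+1) (1 + s)^-(n+2)]; after Fubini only disc areas remain. *)
Lemma integral_complex_oneDnsq (n : nat) : (0 < n)%N ->
  (\int[muC]_z ((1 + nsq z) ^- n.+1)%:E = (unit_disc_area / n%:R)%:E)%E.
Proof.
move=> n0.
pose g (s : R) : R := n.+1%:R * (1 + s) ^- n.+2.
have mg : measurable_fun setT (g : TR -> R).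
  apply: measurable_funM => //.
  by apply: measurable_funV; apply: measurable_funX; exact: measurable_funD.
pose A : set (C * TR) := [set p | nsq p.1 < p.2].
have mA : measurable A.
  have m1 : measurable_fun setT (fun p : C * TR => nsq p.1).
    by apply: (measurableT_comp measurable_nsq).
  have := measurable_fun_ltr m1 (@measurable_snd _ _ C TR).
  move=> /(_ measurableT [set true]); rewrite setTI => h.
  by have := h I; congr measurable; apply/seteqP; split.
pose h (p : C * TR) : \bar R := (\1_A p * g p.2)%:E.
have mh : measurable_fun setT h.
  apply/measurable_EFinP; apply: measurable_funM.
    exact: measurable_indic.
  exact: (measurableT_comp mg).
have h0 p : (0 <= h p)%E.
  rewrite /h indicE; case: (boolP (p \in A)); last by rewrite mul0r.
  rewrite inE /A/= => hp; rewrite mul1r lee_fin mulr_ge0// invr_ge0 exprn_ge0//.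
  by rewrite addr_ge0// ltW// (le_lt_trans (nsq_ge0 p.1)).
transitivity (\int[muC]_z \int[mu]_s h (z, s))%E.
  apply: eq_integral => z _.
  rewrite -(integral_oneDXV_tail n (nsq_ge0 z)) integral_mkcond.
  apply: eq_integral => s _; rewrite patchE /h indicE.
  rewrite (_ : ((z, s) \in A) = (nsq z < s)); last by apply/idP/idP; rewrite inE.
  rewrite mem_setE/= (_ : (s \in `]nsq z, +oo[) = (nsq z < s)); last by rewrite in_itv/= andbT.
  by case: ifP => _; rewrite ?mul1r ?mul0r.
rewrite (fubini_tonelli h)//.
transitivity (\int[mu]_(s in `]0%R, +oo[) (unit_disc_area%:E * (s * g s)%:E))%E.
  rewrite [RHS]integral_mkcond; apply: eq_integral => s _; rewrite patchE.
  rewrite !mem_setE/= in_itv/= andbT; case: ltP => s0.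
    transitivity (\int[muC]_z ((g s)%:E * (\1_[set z : C | nsq z < s] z)%:E))%E.
      by apply: eq_integral => z _; rewrite /h -EFinM mulrC.
    have gs0 : 0 <= g s by rewrite mulr_ge0// invr_ge0 exprn_ge0// addr_ge0// ltW.
    rewrite ge0_integralZl//; last first.
    - apply/measurable_EFinP; apply: measurable_indic; exact: measurable_disc.
    rewrite (integral_disc s).
    by rewrite disc_area// -!EFinM; congr EFin; ring.
  apply: integral0_eq => z _; rewrite /h indicE memNset ?mul0r// /A/=.
  by apply/negP; rewrite -leNgt (le_trans s0)// nsq_ge0.
have [_ k0] := unit_disc_area_bounds.
rewrite ge0_integralZl//; last 3 first.
- by apply/measurable_EFinP/measurable_funTS; apply: measurable_funM.
- move=> s; rewrite /= in_itv/= andbT => s0; rewrite lee_fin.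
  by rewrite !mulr_ge0// ?invr_ge0 ?exprn_ge0 ?addr_ge0// ltW.
- by rewrite lee_fin ltW.
by rewrite integral_idM_oneDXV// -EFinM.
Qed.
End unit_disc.

Section complex_quadratic.
Context {R : realType}.
Local Notation muC := (lebesgue_complex R).
Local Notation C := R[i].
Local Notation kappa := (@unit_disc_area R).

Lemma measurable_nsq_pow (a s : R) (n : nat) :
  measurable_fun setT (fun z : C => ((s + a * nsq z) ^- n)).
Proof.
apply: measurable_funV; apply: measurable_funX; apply: measurable_funD => //.
by apply: measurable_funM => //; exact: measurable_nsq.
Qed.

Lemma addMnsq_gt0 (a s : R) z : 0 < a -> 0 < s -> 0 < s + a * nsq z.
Proof. by move=> a0 s0; rewrite ltr_pwDl// (mulr_ge0 (ltW a0) (nsq_ge0 z)). Qed.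

Lemma integral_complex_DMnsq (a s : R) (n : nat) : 0 < a -> 0 < s -> (0 < n)%N ->
  (\int[muC]_z ((s + a * nsq z) ^- n.+1)%:E = (kappa / n%:R / a * s ^- n)%:E)%E.
Proof.
move=> a0 s0 n0.
pose c := Num.sqrt (s / a).
have c2 : c ^+ 2 = s / a by rewrite sqr_sqrtr// divr_ge0// ltW.
have c0 : 0 < c by rewrite sqrtr_gt0 divr_gt0.
have mf : measurable_fun setT (fun z : C => ((s + a * nsq z) ^- n.+1)%:E).
  by apply/measurable_EFinP; exact: measurable_nsq_pow.
have f0 (z : C) : (0 <= ((s + a * nsq z) ^- n.+1)%:E)%E.
  by rewrite lee_fin invr_ge0 exprn_ge0// ltW// addMnsq_gt0.
have := ge0_integral_complex_affine 0 c0 mf f0.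
under eq_integral => z _.
  rewrite addr0 nsqZ c2 (_ : s + _ = s * (1 + nsq z)); last by field; rewrite gt_eqF.
  rewrite exprMn invfM EFinM; over.
rewrite ge0_integralZl//; last 3 first.
- have := measurable_nsq_pow 1 1 n.+1.
  by under eq_fun do rewrite mul1r; move=> h; apply/measurable_EFinP.
- move=> z _; rewrite lee_fin invr_ge0 exprn_ge0// -[nsq z]mul1r ltW// addMnsq_gt0//.
- by rewrite lee_fin invr_ge0 exprn_ge0// ltW.
rewrite integral_complex_oneDnsq// c2 => H.
have e1 : ((s / a)%:E * (s / a)^-1%:E = 1)%E.
  by rewrite -EFinM mulfV// gt_eqF// divr_gt0.
rewrite -[LHS]mul1e -e1 -muleA -H -!EFinM; congr EFin; rewrite exprS; field.
by rewrite expf_neq0 ?gt_eqF ?ltr0n.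
Qed.

Lemma integral_complex_nsqMDMnsq (a s : R) (n : nat) : 0 < a -> 0 < s -> (0 < n)%N ->
  (\int[muC]_z (nsq z * (s + a * nsq z) ^- n.+2)%:E =
   (kappa / (n%:R * n.+1%:R) / a ^+ 2 * s ^- n)%:E)%E.
Proof.
move=> a0 s0 n0.
have t0 (m : nat) (z : C) : 0 <= (s + a * nsq z) ^- m.
  by rewrite invr_ge0 exprn_ge0// ltW// addMnsq_gt0.
have mI : measurable_fun setT (fun z : C => (nsq z * (s + a * nsq z) ^- n.+2)%:E).
  by apply/measurable_EFinP; apply: measurable_funM;
      [exact: measurable_nsq|exact: measurable_nsq_pow].
have I0 (z : C) : (0 <= (nsq z * (s + a * nsq z) ^- n.+2)%:E)%E.
  by rewrite lee_fin mulr_ge0// nsq_ge0.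
have : (\int[muC]_z ((s + a * nsq z) ^- n.+1)%:E =
  s%:E * \int[muC]_z ((s + a * nsq z) ^- n.+2)%:E +
  a%:E * \int[muC]_z (nsq z * (s + a * nsq z) ^- n.+2)%:E)%E.
  have m1 : measurable_fun setT (fun z : C => ((s + a * nsq z) ^- n.+2)%:E).
    by apply/measurable_EFinP; exact: measurable_nsq_pow.
  rewrite -ge0_integralZl//; try by [rewrite lee_fin ltW|move=> z _; rewrite lee_fin].
  rewrite -ge0_integralZl//; try by [rewrite lee_fin ltW|move=> z _; rewrite lee_fin].
  rewrite -ge0_integralD//; try by [exact: measurable_funeM|
    move=> z _; rewrite mule_ge0// lee_fin// ltW].
  apply: eq_integral => z _; rewrite -!EFinM -EFinD; congr EFin.
  have h : s + a * nsq z != 0 by rewrite gt_eqF// addMnsq_gt0.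
  by rewrite [_ ^+ n.+2]exprS; field; rewrite h expf_neq0.
rewrite !integral_complex_DMnsq//; case: (\int[muC]_z _)%E => [r||].
- rewrite -!EFinM -EFinD => -[] h; congr EFin.
  have -> : r = (kappa / n%:R / a * s ^- n - s * (kappa / n.+1%:R / a * s ^- n.+1)) / a.
    by rewrite h addrC addKr mulrC mulKf ?gt_eqF.
  rewrite exprS -natr1; field.
  by rewrite (gt_eqF s0) (gt_eqF a0) expf_neq0 ?gt_eqF// ?natr1 ltr0n.
- by rewrite gt0_muley ?lte_fin// -EFinM.
- by rewrite gt0_muleNy ?lte_fin// -EFinM.
Qed.

(* The reflection [w |-> - w] of the centred variable [w = z + b] cancels the
   cross terms of [Q]. *)
Lemma integral_complex_sqrD (a s k l : R) (b : C) (n : nat) (Q : C -> R) :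
  0 < a -> 0 < s -> 0 <= k -> 0 <= l -> (0 < n)%N ->
  measurable_fun setT Q -> (forall z, 0 <= Q z) ->
  (forall z, Q (z - b) + Q (- z - b) = 2 * (k * nsq z + l)) ->
  (\int[muC]_z (Q z * (s + a * nsq (z + b)) ^- n.+2)%:E =
   (k * (kappa / (n%:R * n.+1%:R) / a ^+ 2 * s ^- n) +
    l * (kappa / n.+1%:R / a * s ^- n.+1))%:E)%E.
Proof.
move=> a0 s0 k0 l0 n0 mQ Q0 QE.
have t0 (m : nat) (z : C) : 0 <= (s + a * nsq z) ^- m.
  by rewrite invr_ge0 exprn_ge0// ltW// addMnsq_gt0.
have msh c : measurable_fun setT (fun z : C => z + c : C).
  exact: measurable_complexD.
pose f (z : C) := (Q z * (s + a * nsq (z + b)) ^- n.+2)%:E.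
have f0 z : (0 <= f z)%E by rewrite lee_fin mulr_ge0.
have mf : measurable_fun setT f.
  apply/measurable_EFinP/measurable_funM => //.
  exact: (measurableT_comp (measurable_nsq_pow a s n.+2) (msh b)).
have fE : (\int[muC]_z f z = \int[muC]_z f (z - b)%R)%E.
  have := ge0_integral_complex_affine (- b) ltr01 mf f0.
  rewrite expr1n invr1 mul1e => <-; apply: eq_integral => z _.
  by rewrite mul1r.
have mfb : measurable_fun setT (fun z : C => f (z - b)%R).
  by apply: (measurableT_comp mf); exact: msh.
have mfN : measurable_fun setT (fun z : C => f (- z - b)%R).
  by apply: (measurableT_comp mfb); exact: measurable_complexN.
have fN : (\int[muC]_z f z = \int[muC]_z f (- z - b)%R)%E.
  by rewrite fE -(ge0_integral_complex_opp mfb).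
have h2 : (2%:E * \int[muC]_z f z =
    2%:E * (k%:E * \int[muC]_z (nsq z * (s + a * nsq z) ^- n.+2)%:E +
            l%:E * \int[muC]_z ((s + a * nsq z) ^- n.+2)%:E))%E.
  rewrite mule_natl mule2n {1}fE fN -ge0_integralD//.
  have m1 : measurable_fun setT (fun z : C => (nsq z * (s + a * nsq z) ^- n.+2)%:E).
    by apply/measurable_EFinP; apply: measurable_funM;
      [exact: measurable_nsq|exact: measurable_nsq_pow].
  have m2 : measurable_fun setT (fun z : C => ((s + a * nsq z) ^- n.+2)%:E).
    by apply/measurable_EFinP; exact: measurable_nsq_pow.
  have p1 (z : C) : (0 <= (nsq z * (s + a * nsq z) ^- n.+2)%:E)%E.
    by rewrite lee_fin mulr_ge0// nsq_ge0.
  rewrite -ge0_integralZl// -ge0_integralZl//; try by move=> z _; rewrite lee_fin.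
  rewrite -ge0_integralD//; try by [exact: measurable_funeM|
    move=> z _; rewrite mule_ge0// lee_fin].
  rewrite -ge0_integralZl//; try by [
    apply: emeasurable_funD; exact: measurable_funeM|
    move=> z _; rewrite adde_ge0// mule_ge0// lee_fin].
  apply: eq_integral => z _; rewrite /f -!EFinM -!EFinD; congr EFin.
  rewrite !subrK (_ : nsq (- z) = nsq z); last first.
    by case: (z) => x y; rewrite /nsq/= !sqrrN.
  by rewrite -mulrDl QE; ring.
move: h2; rewrite integral_complex_nsqMDMnsq// integral_complex_DMnsq//.
move=> /(congr1 (fun x => (2^-1)%:E * x)%E).
rewrite !muleA -EFinM mulVf ?pnatr_eq0// !mul1e /f => ->.
by rewrite -!EFinM -EFinD.
Qed.

Lemma integral_complex_DMnsqD (a s : R) (b : C) (n : nat) :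
  0 < a -> 0 < s -> (0 < n)%N ->
  (\int[muC]_z ((s + a * nsq (z + b)) ^- n.+1)%:E =
   (kappa / n%:R / a * s ^- n)%:E)%E.
Proof.
move=> a0 s0 n0.
have mf : measurable_fun setT (fun z : C => ((s + a * nsq z) ^- n.+1)%:E).
  by apply/measurable_EFinP; exact: measurable_nsq_pow.
have f0 (z : C) : (0 <= ((s + a * nsq z) ^- n.+1)%:E)%E.
  by rewrite lee_fin invr_ge0 exprn_ge0// ltW// addMnsq_gt0.
rewrite -integral_complex_DMnsq//.
have := ge0_integral_complex_affine b ltr01 mf f0.
rewrite expr1n invr1 mul1e => <-; apply: eq_integral => z _.
by rewrite mul1r.
Qed.
End complex_quadratic.

(** * Integrals of hermitian forms to negative powers on C^n *)

Section tuple_integral.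
Context {R : realType}.
Local Notation C := R[i].
Local Notation muC := (lebesgue_complex R).
Local Notation muCn := (lebesgue_Cn R).

Lemma ge0_integral_Cn0 (f : 0.-tuple C -> \bar R) :
  (\int[muCn 0]_t f t = f [tuple])%E.
Proof.
have mf : measurable_fun setT f.
  move=> _ B mB; rewrite setTI.
  have [h|h] := pselect (B (f [tuple])).
    rewrite (_ : _ @^-1` _ = setT)//; apply/seteqP; split => // t _.
    by rewrite /= tuple0.
  by rewrite (_ : _ @^-1` _ = set0)//; apply/seteqP; split => // t; rewrite /= tuple0.
by rewrite integral_dirac// diracT mul1e.
Qed.

Lemma ge0_integral_CnS n (f : n.+1.-tuple C -> \bar R) :
  measurable_fun setT f -> (forall t, 0 <= f t)%E ->
  (\int[muCn n.+1]_t f t = \int[muC]_z \int[muCn n]_t f [tuple of z :: t])%E.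
Proof.
move=> mf f0; rewrite ge0_integral_sigma_finite_pushforward//.
rewrite ge0_integral_product_sigma//.
by apply: (measurableT_comp mf); exact: measurable_tcons.
Qed.

Lemma ge0_integral_CnS_swap n (f : n.+1.-tuple C -> \bar R) :
  measurable_fun setT f -> (forall t, 0 <= f t)%E ->
  (\int[muCn n.+1]_t f t = \int[muCn n]_t \int[muC]_z f [tuple of z :: t])%E.
Proof.
move=> mf f0; rewrite ge0_integral_CnS//.
rewrite (@fubini_tonelli _ _ _ _ _ muC (muCn n) (fun p => f [tuple of p.1 :: p.2]))//.
by apply: (measurableT_comp mf); exact: measurable_tcons.
Qed.

Lemma measurable_tuple_cat m n :
  measurable_fun setT (fun p : m.-tuple C * n.-tuple C => [tuple of p.1 ++ p.2]).
Proof.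
apply/measurable_fun_tnthP => i; case: (split_ordP i) => k ->; rewrite /comp.
  under eq_fun do rewrite tnth_lshift.
  by apply: (measurableT_comp (measurable_tnth k)).
under eq_fun do rewrite tnth_rshift.
by apply: (measurableT_comp (measurable_tnth k)).
Qed.

Lemma ge0_integral_Cn_cat m n k (e : k = (m + n)%N) (f : seq C -> \bar R) :
  measurable_fun setT (fun t : k.-tuple C => f t) -> (forall t, 0 <= f t)%E ->
  (\int[muCn k]_t f t = \int[muCn m]_u \int[muCn n]_v f (u ++ v))%E.
Proof.
subst k; elim: m f => [|m IH] f mf f0; first by rewrite ge0_integral_Cn0.
rewrite (@ge0_integral_CnS (m + n) (fun t => f t))//.
rewrite (@ge0_integral_CnS m (fun t => \int[muCn n]_v f (t ++ v))%E); last 2 first.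
- have mg : measurable_fun setT
      (fun p : m.+1.-tuple C * n.-tuple C => f (p.1 ++ p.2)).
    exact: (measurableT_comp mf (@measurable_tuple_cat m.+1 n)).
  exact: (measurable_fun_fubini_tonelli_F (m2 := muCn n) _ mg (fun p => f0 _)).
- by move=> t; exact: integral_ge0.
apply: eq_integral => z _; rewrite (IH (fun s => f (z :: s)))//.
apply: (measurableT_comp (f := fun t : (m + n).+1.-tuple C => f t)
  (g := fun t : (m + n).-tuple C => [tuple of z :: t])) => //.
exact: measurable_cons.
Qed.
End tuple_integral.

Section hermitian.
Context {R : realType}.
Local Notation C := R[i].

Lemma adjmxM m n p (A : 'M[C]_(m, n)) (B : 'M[C]_(n, p)) :
  (A *m B)^t* = B^t* *m A^t*.
Proof. by rewrite trmx_mul map_mxM. Qed.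

Lemma adjmxD m n (A B : 'M[C]_(m, n)) : (A + B)^t* = A^t* + B^t*.
Proof. by rewrite raddfD/= map_mxD. Qed.

Lemma adjmxN m n (A : 'M[C]_(m, n)) : (- A)^t* = - A^t*.
Proof. by rewrite raddfN/= map_mxN. Qed.

Lemma adjmxZ m n (a : C) (A : 'M[C]_(m, n)) : (a *: A)^t* = a^* *: A^t*.
Proof. by apply/matrixP => i j; rewrite !mxE rmorphM. Qed.

Lemma adjmxK m n (A : 'M[C]_(m, n)) : (A^t*)^t* = A.
Proof. by apply/matrixP => i j; rewrite !mxE conjCK. Qed.

Lemma adjmx1 n : (1%:M : 'M[C]_n)^t* = 1%:M.
Proof. by rewrite trmx1 map_mx1. Qed.

Definition hform m (M : 'M[C]_m) (u : 'rV[C]_m) : R :=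
  complex.Re ((u *m M *m u^t*) 0 0).

Definition posdefmx m (M : 'M[C]_m) :=
  M^t* = M /\ forall u, u != 0 -> 0 < hform M u.

Definition psdmx m (K : 'M[C]_m) := forall u, 0 <= hform K u.

Lemma ReD (x y : C) : complex.Re (x + y) = complex.Re x + complex.Re y.
Proof. by case: x y => ? ? []. Qed.

Lemma ReN (x : C) : complex.Re (- x) = - complex.Re x.
Proof. by case: x. Qed.

Lemma ReZ (a : R) (x : C) : complex.Re (a%:C * x) = a * complex.Re x.
Proof. by case: x => x y; rewrite /= mul0r subr0. Qed.

Lemma hform_congr m n (M : 'M[C]_n) (L : 'M[C]_(m, n)) u :
  hform (L *m M *m L^t*) u = hform M (u *m L).
Proof. by rewrite /hform adjmxM !mulmxA. Qed.

Lemma hform_parallelogram m (K : 'M[C]_m) x y :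
  hform K (x + y) + hform K (- x + y) = 2 * (hform K x + hform K y).
Proof.
rewrite /hform !adjmxD adjmxN !(mulmxDl, mulmxDr, mulNmx, mulmxN).
rewrite !mxE !(ReD, ReN); ring.
Qed.

Lemma Re_mulc_conj (z w : C) : complex.Re (z * w * z^*) = nsq z * complex.Re w.
Proof. by case: z w => x y [a b]; rewrite /nsq/=; ring. Qed.

Lemma hformZ m (K : 'M[C]_m) (z : C) u : hform K (z *: u) = nsq z * hform K u.
Proof.
rewrite /hform adjmxZ -scalemxAl -scalemxAl -scalemxAr.
rewrite 2!mxE. by rewrite mulrA mulrAC Re_mulc_conj.
Qed.

Lemma hformD_orth m (M : 'M[C]_m) x y : M^t* = M ->
  x *m M *m y^t* = 0 -> hform M (x + y) = hform M x + hform M y.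
Proof.
move=> hM xy; rewrite /hform adjmxD !(mulmxDl, mulmxDr) xy.
have -> : y *m M *m x^t* = 0.
  have := congr1 (fun A : 'M[C]_1 => A^t*) xy.
  by rewrite !adjmxM adjmxK hM mulmxA trmx0 map_mx0.
by rewrite addr0 add0r mxE ReD.
Qed.

Lemma adjmx_row_mx m n1 n2 (A : 'M[C]_(m, n1)) (B : 'M[C]_(m, n2)) :
  (row_mx A B)^t* = col_mx (A^t*) (B^t*).
Proof. by rewrite tr_row_mx map_col_mx. Qed.

Lemma adjmx_col_mx m1 m2 n (A : 'M[C]_(m1, n)) (B : 'M[C]_(m2, n)) :
  (col_mx A B)^t* = row_mx (A^t*) (B^t*).
Proof. by rewrite tr_col_mx map_row_mx. Qed.

Section schur_complement.
Variables (m : nat) (M : 'M[C]_(1 + m)).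
Hypothesis pM : posdefmx M.

(* In the basis formed by the first coordinate vector [piv_row] and the rows of
   [piv_compl], [M] is block diagonal: congruence by [piv_compl] yields the Schur
   complement of the pivot [M 0 0], and every hermitian form [K] integrated
   against [M] is transported by the same congruence. *)
Definition piv_row : 'rV[C]_(1 + m) := row_mx 1%:M 0.
Definition piv_coef : 'cV[C]_m := (M 0 0)^-1 *: dlsubmx M.
Definition piv_compl : 'M[C]_(m, 1 + m) := row_mx (- piv_coef) 1%:M.
Local Notation e := piv_row.
Local Notation L := piv_compl.

Lemma piv_row_neq0 : e != 0.
Proof.
apply/eqP => /matrixP/(_ 0 (lshift m 0)); rewrite row_mxEl !mxE eqxx => /eqP.
by rewrite oner_eq0.
Qed.

Lemma piv_rowE (A : 'M[C]_(1 + m)) : e *m A *m e^t* = (A 0 0)%:M.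
Proof.
rewrite adjmx_row_mx adjmx1 trmx0 map_mx0 -{1}[A]submxK /e.
rewrite mul_row_block !mul0mx !mul1mx !addr0.
rewrite mul_row_col mulmx1 mulmx0 addr0 [LHS]mx11_scalar; congr (_%:M).
by rewrite !mxE; congr (A _ _); apply/val_inj.
Qed.

Lemma hform_piv (A : 'M[C]_(1 + m)) : hform A e = complex.Re (A 0 0).
Proof. by rewrite /hform piv_rowE !mxE eqxx. Qed.

Lemma piv_gt0 : 0 < hform M e.
Proof. by case: pM => _; apply; exact: piv_row_neq0. Qed.

Lemma piv_real : M 0 0 = (hform M e)%:C.
Proof.
rewrite hform_piv; case: pM => hM _.
have /matrixP/(_ 0 0) := hM; rewrite !mxE.
case: (M 0 0) => x y [] h; congr (_ +i* _).
lra.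
Qed.

Lemma piv_neq0 : M 0 0 != 0.
Proof. by rewrite piv_real eq_complex/= eqxx andbT gt_eqF// piv_gt0. Qed.

Lemma piv_conj : (M 0 0)^*%R = M 0 0.
Proof. by rewrite piv_real; apply/eqP; rewrite eq_complex/= oppr0 !eqxx. Qed.

Lemma piv_conjV : (M 0 0)^-1^*%R = (M 0 0)^-1.
Proof.
apply: (mulfI piv_neq0); rewrite mulfV ?piv_neq0// -[X in X * _]piv_conj.
by rewrite -rmorphM mulfV ?piv_neq0// rmorph1.
Qed.

Lemma piv_orth : e *m M *m L^t* = 0.
Proof.
case: pM => hM _.
rewrite adjmx_row_mx adjmx1 adjmxN /piv_coef adjmxZ /e -{1}[M]submxK.
rewrite mul_row_block !mul0mx !mul1mx !addr0 mul_row_col mulmx1.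
have -> : (dlsubmx M)^t* = ursubmx M.
  by rewrite -[in RHS]hM; apply/matrixP => i j; rewrite !mxE.
rewrite [ulsubmx M]mx11_scalar mul_scalar_mx scalerN scalerA !mxE.
rewrite (_ : lshift m 0 = 0); last exact/val_inj.
by rewrite piv_conjV mulfV ?piv_neq0// scale1r addNr.
Qed.

Definition piv_mx : 'M[C]_(1 + m) := col_mx e L.
Local Notation P := piv_mx.
Local Notation M' := (L *m M *m L^t*).

Lemma det_piv_mx : \det P = 1.
Proof.
rewrite /piv_mx /e /piv_compl -[col_mx _ _]/(block_mx 1%:M 0 (- piv_coef) 1%:M).
by rewrite det_lblock !det1 mulr1.
Qed.

Lemma piv_mxE (K : 'M[C]_(1 + m)) :
  P *m K *m P^t* = block_mx (K 0 0)%:M (e *m K *m L^t*) (L *m K *m e^t*) (L *m K *m L^t*).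
Proof. by rewrite /piv_mx mul_col_mx adjmx_col_mx mul_col_row piv_rowE. Qed.

Lemma piv_mx_diag : P *m M *m P^t* = block_mx (M 0 0)%:M 0 0 M'.
Proof.
rewrite piv_mxE piv_orth; congr block_mx.
have := congr1 (fun A : 'M[C]_(1, m) => A^t*) piv_orth; case: pM => hM _.
by rewrite !adjmxM adjmxK hM mulmxA trmx0 map_mx0.
Qed.

Lemma det_schur : \det M = M 0 0 * \det M'.
Proof.
have := congr1 determinant piv_mx_diag.
rewrite !det_mulmx det_map_mx det_tr det_piv_mx rmorph1 mul1r mulr1.
by rewrite det_ublock det_scalar1.
Qed.

Lemma posdef_schur : posdefmx M'.
Proof.
case: pM => hM pos; split.
  by rewrite !adjmxM adjmxK hM mulmxA.
move=> u u0; rewrite hform_congr; apply: pos; apply: contra u0 => /eqP.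
by rewrite /piv_compl mul_mx_row mulmx1 -row_mx0 => /eq_row_mx[_ ->].
Qed.

Lemma trace_schur (K : 'M[C]_(1 + m)) : M' \in unitmx ->
  \tr (K *m invmx M) = (M 0 0)^-1 * K 0 0 + \tr (L *m K *m L^t* *m invmx M').
Proof.
move=> uM'.
have uP : P \in unitmx by rewrite unitmxE det_piv_mx unitr1.
have uM : M \in unitmx.
  by rewrite unitmxE det_schur unitrM unitfE piv_neq0 -unitmxE.
pose D : 'M[C]_(1 + m) := block_mx (M 0 0)^-1%:M 0 0 (invmx M').
have PD : P *m M *m P^t* *m D = 1%:M.
  rewrite piv_mx_diag /D mulmx_block !(mulmx0, mul0mx, addr0, add0r).
  by rewrite mulmxV// -scalar_mxM mulfV ?piv_neq0// -scalar_mx_block.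
have -> : invmx M = P^t* *m D *m P.
  have := congr1 (fun A => invmx P *m A *m P) PD.
  rewrite !mulmxA mulVmx// mul1mx mulmx1 mulVmx// => MX.
  rewrite -[RHS]mul1mx -(mulVmx uM) -!mulmxA -[LHS]mulmx1.
  by congr (_ *m _); rewrite -MX !mulmxA.
rewrite mulmxA mxtrace_mulC !mulmxA piv_mxE /D mulmx_block mxtrace_block.
rewrite !mulmx0 addr0 add0r -scalar_mxM; congr (_ + _).
by rewrite mxtrace_scalar mulr1n mulrC.
Qed.

Lemma row_mx_piv (z : C) (w : 'rV[C]_m) :
  row_mx z%:M w = (z + (w *m piv_coef) 0 0) *: e + w *m L.
Proof.
rewrite /e /piv_compl mul_mx_row mulmx1 scale_row_mx scaler0 add_row_mx add0r.
rewrite mulmxN; congr row_mx; apply/matrixP => i j.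
by rewrite !ord1 !mxE eqxx !mulr1n mulr1 addrK.
Qed.

Lemma hform_schur (z : C) (w : 'rV[C]_m) :
  hform M (row_mx z%:M w) =
  hform M e * nsq (z + (w *m piv_coef) 0 0) + hform M' w.
Proof.
rewrite row_mx_piv hformD_orth; first by rewrite hformZ hform_congr mulrC.
- by case: pM.
- by rewrite -!scalemxAl adjmxM !mulmxA piv_orth mul0mx scaler0.
Qed.

Lemma hform_piv_sym (K : 'M[C]_(1 + m)) (w : 'rV[C]_m) (z : C) :
  let b := (w *m piv_coef) 0 0 in
  hform K (row_mx (z - b)%:M w) + hform K (row_mx (- z - b)%:M w) =
  2 * (hform K e * nsq z + hform (L *m K *m L^t*) w).
Proof.
move=> b; rewrite !row_mx_piv -/b !subrK scaleNr hform_parallelogram.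
by rewrite hformZ hform_congr [nsq z * _]mulrC.
Qed.

End schur_complement.

Lemma posdef_det m (M : 'M[C]_m) : posdefmx M ->
  \det M = (complex.Re (\det M))%:C /\ 0 < complex.Re (\det M).
Proof.
elim: m M => [|m IH] M pM; first by rewrite det_mx00.
rewrite (det_schur (pM : posdefmx (M : 'M[C]_(1 + m)))).
have [-> d0] := IH _ (posdef_schur (pM : posdefmx (M : 'M[C]_(1 + m)))).
rewrite (piv_real (pM : posdefmx (M : 'M[C]_(1 + m)))) ReZ.
split; last by rewrite mulr_gt0// piv_gt0.
by rewrite rmorphM.
Qed.

Lemma posdef_unit m (M : 'M[C]_m) : posdefmx M -> M \in unitmx.
Proof.
by move=> /posdef_det[h h0]; rewrite unitmxE h unitfE eq_complex/= eqxx andbT gt_eqF.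
Qed.

End hermitian.

Section quadratic_integral.
Context {R : realType}.
Local Notation C := R[i].
Local Notation muC := (lebesgue_complex R).
Local Notation muCn := (lebesgue_Cn R).
Local Notation kappa := (@unit_disc_area R).

Definition row_of_tuple m (t : m.-tuple C) : 'rV[C]_m := \row_j tnth t j.

Lemma row_of_tuple_cons m (z : C) (t : m.-tuple C) :
  row_of_tuple [tuple of z :: t] = row_mx z%:M (row_of_tuple t) :> 'rV[C]_(1 + m).
Proof.
apply/matrixP => i j; rewrite !mxE; case: splitP => k jk.
  rewrite !ord1 !mxE eqxx mulr1n (_ : j = ord0) ?tnth0//.
  by apply/val_inj; rewrite /= jk ord1.
rewrite mxE (_ : j = lift ord0 k) ?tnthS//.
by apply/val_inj; rewrite /= jk.
Qed.

Lemma measurable_row_of_tuple m :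
  measurable_mx (fun t : m.-tuple C => row_of_tuple t).
Proof. by move=> i j; under eq_fun do rewrite mxE; exact: measurable_tnth. Qed.

Lemma measurable_hform d (T : measurableType d) m (M : 'M[C]_m) (F : T -> 'rV[C]_m) :
  measurable_mx F -> measurable_fun setT (fun t => hform M (F t)).
Proof.
move=> mF; apply: measurable_complexRe.
apply: measurable_mxM; last exact: measurable_mx_adj.
by apply: measurable_mxM => //; exact: measurable_mx_cst.
Qed.

Lemma measurable_hform_tuple m (M : 'M[C]_m) :
  measurable_fun setT (fun t : m.-tuple C => hform M (row_of_tuple t)).
Proof. by apply: measurable_hform; exact: measurable_row_of_tuple. Qed.

Lemma measurable_hform_pow m (M : 'M[C]_m) (c : R) n :
  measurable_fun setT (fun t : m.-tuple C => ((c + hform M (row_of_tuple t)) ^- n)).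
Proof.
apply: measurable_funV; apply: measurable_funX; apply: measurable_funD => //.
exact: measurable_hform_tuple.
Qed.

Lemma posdef_psd m (M : 'M[C]_m) : posdefmx M -> psdmx M.
Proof.
move=> [_ pM] u; have [->|/pM/ltW//] := eqVneq u 0.
by rewrite /hform mul0mx mul0mx mxE.
Qed.

Definition hform_const (m j : nat) : R := kappa ^+ m * j`!%:R / (m + j)`!%:R.

Lemma hform_const_gt0 m j : 0 < hform_const m j.
Proof.
have [_ k0] := @unit_disc_area_bounds R.
by rewrite divr_gt0 ?mulr_gt0 ?exprn_gt0// ltr0n fact_gt0.
Qed.

Lemma integral_hform m (M : 'M[C]_m) (c : R) (j : nat) :
  posdefmx M -> 0 < c ->
  (\int[muCn m]_t ((c + hform M (row_of_tuple t)) ^- (m + j).+1)%:E =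
   (hform_const m j / complex.Re (\det M) * c ^- j.+1)%:E)%E.
Proof.
move=> + c0; elim: m M => [|m IH] M pM.
  rewrite ge0_integral_Cn0 /hform_const det_mx00/= expr0 mul1r.
  rewrite mulfV ?pnatr_eq0 -?lt0n ?fact_gt0//.
  by rewrite divr1 mul1r add0n /hform mxE big_ord0 addr0.
have pow0 t : 0 <= (c + hform M (row_of_tuple t)) ^- (m.+1 + j).+1.
  by rewrite invr_ge0 exprn_ge0// addr_ge0 ?(ltW c0)//; exact: posdef_psd.
rewrite ge0_integral_CnS_swap//; try by [
  apply/measurable_EFinP; exact: measurable_hform_pow|
  move=> t; rewrite lee_fin].
have pM1 : posdefmx (M : 'M[C]_(1 + m)) := pM.
set M' := (piv_compl (M : 'M[C]_(1 + m))) *m M *m (piv_compl (M : 'M[C]_(1 + m)))^t*.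
have pM' : posdefmx M' := posdef_schur pM1.
set a := hform (M : 'M[C]_(1 + m)) (piv_row m).
have a0 : 0 < a := piv_gt0 pM1.
have s0 t : 0 < c + hform M' (row_of_tuple t).
  by rewrite ltr_pwDl//; exact: posdef_psd.
transitivity (\int[muCn m]_t ((kappa / (m + j).+1%:R / a)%:E *
    ((c + hform M' (row_of_tuple t)) ^- (m + j).+1)%:E))%E.
  apply: eq_integral => t _.
  under eq_integral => z _.
    rewrite row_of_tuple_cons (hform_schur pM1) -/a -/M'.
    rewrite addrCA [X in X ^- _]addrC.
    over.
  rewrite addSn integral_complex_DMnsqD// ?mulr1//.
rewrite ge0_integralZl//; try by [
  apply/measurable_EFinP; exact: measurable_hform_pow|
  move=> t _; rewrite lee_fin invr_ge0 exprn_ge0// ltW|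
  have [_ k0] := @unit_disc_area_bounds R; rewrite lee_fin !divr_ge0// ltW].
rewrite IH// (det_schur pM1) (piv_real pM1) ReZ -/a -/M' -EFinM; congr EFin.
have [_ d0] := posdef_det pM'.
rewrite /hform_const addSn factS (exprS kappa) natrM.
have /negbT x0 := gt_eqF (ltr0Sn R (m + j)).
have /negbT y0 : ((m + j)`!%:R == 0 :> R) = false by rewrite gt_eqF// ltr0n fact_gt0.
set x := (m + j).+1%:R in x0 *; set y := (m + j)`!%:R in y0 *; set w := c ^+ j.+1.
have w0 : w != 0 by rewrite gt_eqF// exprn_gt0.
set dd := complex.Re (\det M') in d0 *.
by field; rewrite w0 y0 (gt_eqF d0) (gt_eqF a0)/= -natrD nat1r pnatr_eq0.
Qed.

Lemma integral_hformM m (M K : 'M[C]_m) (c : R) (j : nat) :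
  posdefmx M -> psdmx K -> 0 < c -> (0 < j)%N ->
  (\int[muCn m]_t (hform K (row_of_tuple t) *
      (c + hform M (row_of_tuple t)) ^- (m + j).+1)%:E =
   (hform_const m j / complex.Re (\det M) * c ^- j *
      (complex.Re (\tr (K *m invmx M)) / j%:R))%:E)%E.
Proof.
move=> + + c0 j0; elim: m M K => [|m IH] M K pM pK.
  rewrite ge0_integral_Cn0 /mxtrace big_ord0/= mul0r mulr0.
  by rewrite {1}/hform mxE big_ord0/= mul0r.
have pow0 t : 0 <= (c + hform M (row_of_tuple t)) ^- (m.+1 + j).+1.
  by rewrite invr_ge0 exprn_ge0// addr_ge0 ?(ltW c0)//; exact: posdef_psd.
rewrite ge0_integral_CnS_swap//; try by [
  apply/measurable_EFinP; apply: measurable_funM;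
    [exact: measurable_hform_tuple|exact: measurable_hform_pow]|
  move=> t; rewrite lee_fin mulr_ge0].
have pM1 : posdefmx (M : 'M[C]_(1 + m)) := pM.
set L := piv_compl (M : 'M[C]_(1 + m)).
set M' := L *m M *m L^t*; set K' := L *m K *m L^t*.
have pM' : posdefmx M' := posdef_schur pM1.
have pK' : psdmx K' by move=> u; rewrite hform_congr; exact: pK.
set a := hform (M : 'M[C]_(1 + m)) (piv_row m).
have a0 : 0 < a := piv_gt0 pM1.
set k := hform (K : 'M[C]_(1 + m)) (piv_row m).
have k0 : 0 <= k by exact: pK.
have s0 t : 0 < c + hform M' (row_of_tuple t).
  by rewrite ltr_pwDl//; exact: posdef_psd.
have [n nE] : exists n, (m + j)%N = n.+1.
  by exists (m + j).-1; rewrite prednK// addn_gt0 j0 orbT.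
have eJ : (m + j.-1).+1 = (m + j)%N by rewrite -addnS prednK.
have [_ kap0] := @unit_disc_area_bounds R.
pose A := k * (kappa / ((m + j)%:R * (m + j).+1%:R) / a ^+ 2).
pose B := kappa / (m + j).+1%:R / a.
have A0 : 0 <= A by rewrite mulr_ge0// !divr_ge0// ?exprn_ge0// ltW.
have B0 : 0 <= B by rewrite !divr_ge0// ltW.
have pow0' i t : 0 <= (c + hform M' (row_of_tuple t)) ^- i.
  by rewrite invr_ge0 exprn_ge0// ltW.
transitivity (\int[muCn m]_t
    (A%:E * ((c + hform M' (row_of_tuple t)) ^- (m + j.-1).+1)%:E +
     B%:E * (hform K' (row_of_tuple t) *
             (c + hform M' (row_of_tuple t)) ^- (m + j).+1)%:E))%E.
  apply: eq_integral => t _.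
  under eq_integral => z _.
    rewrite row_of_tuple_cons (hform_schur pM1) -/a -/M'.
    rewrite addrCA [X in X ^- _]addrC.
    over.
  rewrite -!EFinM -EFinD addSn.
  rewrite (@integral_complex_sqrD R a (c + hform M' (row_of_tuple t)) k
    (hform K' (row_of_tuple t)) _ (m + j)
    (fun z => hform (K : 'M[C]_(1 + m)) (row_mx z%:M (row_of_tuple t))))//.
  - by rewrite eJ; congr EFin; rewrite /A /B; ring.
  - by rewrite nE.
  - apply: measurable_hform => p q; rewrite /row_mx.
    under eq_fun do rewrite mxE; case: (fintype.split q) => q'; last exact: measurable_cst.
    rewrite !ord1; under eq_fun do rewrite mxE eqxx mulr1n.
    exact: measurable_id.
  - by move=> z; rewrite hform_piv_sym.
have mK : measurable_fun setT (fun t : m.-tuple C => (hform K' (row_of_tuple t) *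
    (c + hform M' (row_of_tuple t)) ^- (m + j).+1)%:E).
  by apply/measurable_EFinP; apply: measurable_funM;
    [exact: measurable_hform_tuple|exact: measurable_hform_pow].
have mM i : measurable_fun setT (fun t : m.-tuple C =>
    ((c + hform M' (row_of_tuple t)) ^- i)%:E).
  by apply/measurable_EFinP; exact: measurable_hform_pow.
rewrite ge0_integralD//; try by [exact: measurable_funeM|
  move=> t _; rewrite mule_ge0// lee_fin// mulr_ge0].
rewrite ge0_integralZl//; try by move=> t _; rewrite lee_fin.
rewrite ge0_integralZl//; try by move=> t _; rewrite lee_fin mulr_ge0.
rewrite IH// integral_hform// prednK// -!EFinM -EFinD; congr EFin.
rewrite (det_schur pM1) (trace_schur pM1) ?posdef_unit// (piv_real pM1) ReD ReZ.
rewrite -/a -/M' -/K'.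
rewrite -[((a)%:C)^-1]fmorphV ReZ -(hform_piv (K : 'M[C]_(1 + m))) -/k.
have [_ d0] := posdef_det pM'.
clear A0 B0 eJ nE n pow0' mK mM s0 IH pow0; rewrite {}/A {}/B; clearbody a k.
set dd := complex.Re (\det M') in d0 *; set tr := complex.Re _; clearbody dd tr.
case: j j0 => // i _; rewrite /= /hform_const addSn !addnS !factS (exprS kappa) !natrM.
have y0 : ((m + i)`!%:R != 0 :> R) by rewrite pnatr_eq0 -lt0n fact_gt0.
have w0 : c ^+ i.+1 != 0 by rewrite gt_eqF// exprn_gt0.
set y := (m + i)`!%:R in y0 *; set w := c ^+ i.+1 in w0 *; clearbody y w.
have q0 : 0 <= m%:R + i%:R :> R by rewrite addr_ge0.
by field; rewrite w0 y0 (gt_eqF d0) (gt_eqF a0)/= nat1r pnatr_eq0/= !gt_eqF// ltr_pwDl.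
Qed.
End quadratic_integral.

(** * Recursion on the Schur form *)

Lemma strict_upper_positionsS n :
  strict_upper_positions n.+1 =
  [seq (ord0, lift ord0 j) | j <- enum 'I_n] ++
  [seq (lift ord0 p.1, lift ord0 p.2) | p <- strict_upper_positions n].
Proof.
rewrite /strict_upper_positions !enumT !unlock /= /prod_enum enum_ordSl /= filter_cat.
congr (_ ++ _).
  rewrite -map_comp filter_map /=; congr map.
  by rewrite (eq_filter (a2 := predT))// filter_predT enumT unlock.
rewrite !filter_flatten map_flatten; congr flatten.
rewrite -!map_comp; apply: eq_map => i /=.
rewrite -map_comp !filter_map /= -!map_comp.
by congr map; apply: eq_filter => j; rewrite /= /bump /= ltn_add2l.
Qed.

Lemma upper_dimS n : upper_dim n.+1 = (n + upper_dim n)%N.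
Proof.
rewrite /upper_dim strict_upper_positionsS size_cat.
by rewrite size_map size_enum_ord size_map.
Qed.

Lemma index_upper0 n (j : 'I_n) :
  index (ord0, lift ord0 j) (strict_upper_positions n.+1) = j.
Proof.
rewrite strict_upper_positionsS index_cat mem_map ?mem_enum; last first.
  by move=> a b /(congr1 snd)/lift_inj.
by rewrite index_map ?index_enum_ord// => a b /(congr1 snd)/lift_inj.
Qed.

Lemma index_upperS n (i j : 'I_n) :
  index (lift ord0 i, lift ord0 j) (strict_upper_positions n.+1) =
  (n + index (i, j) (strict_upper_positions n))%N.
Proof.
rewrite strict_upper_positionsS index_cat size_map size_enum_ord ifF; last first.
  by apply/negbTE/mapP => -[k _ []] /eqP.
rewrite -[(lift _ _, lift _ _)]/((fun p => (lift ord0 p.1, lift ord0 p.2)) (i, j)).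
rewrite index_map// => -[a b] [c d] /= e.
by have /lift_inj-> := congr1 fst e; have /lift_inj-> := congr1 snd e.
Qed.

Section upper_matrix.
Context {R : realType}.
Local Notation C := R[i].

Definition upper_seq n (l t : seq C) : 'M[C]_n :=
  \matrix_(i, j) if i == j then nth 0 l i
    else if (i < j)%N then nth 0 t (index (i, j) (strict_upper_positions n))
    else 0.

Lemma upper_mxE n (lam : n.-tuple C) (t : (upper_dim n).-tuple C) :
  upper_mx lam t = upper_seq n lam t.
Proof. by apply/matrixP => i j; rewrite !mxE (tnth_nth 0). Qed.

Lemma upper_seqS n (x : C) (l v : seq C) (u : n.-tuple C) :
  upper_seq n.+1 (x :: l) (u ++ v) =
  block_mx x%:M (row_of_tuple u) 0 (upper_seq n l v) :> 'M[C]_(1 + n).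
Proof.
apply/matrixP => i j; rewrite !mxE.
have l0 m (k : 'I_1) : lshift m k = ord0 by rewrite ord1; exact: val_inj.
have rl m (k : 'I_m) : rshift 1 k = lift ord0 k by exact: val_inj.
case: splitP => i' ii'.
  have -> : i = ord0 by apply: val_inj; rewrite /= ii' ord1.
  rewrite mxE; case: splitP => j' jj'.
    have -> : j = ord0 by apply: val_inj; rewrite /= jj' ord1.
    by rewrite !ord1 !mxE eqxx mulr1n.
  have -> : j = lift ord0 j' by apply: val_inj; rewrite /= jj'.
  by rewrite /= mxE index_upper0 nth_cat size_tuple ltn_ord (tnth_nth 0).
have -> : i = lift ord0 i' by apply: val_inj; rewrite /= ii'.
rewrite mxE; case: splitP => j' jj'.
  have -> : j = ord0 by apply: val_inj; rewrite /= jj' ord1.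
  by rewrite mxE.
have -> : j = lift ord0 j' by apply: val_inj; rewrite /= jj'.
rewrite mxE (inj_eq lift_inj) index_upperS nth_cat size_tuple [(n + _ < n)%N]ltnNge leq_addr/=.
by rewrite addKn /bump !add1n ltnS.
Qed.

End upper_matrix.

Section block_det.
Context {R : realType}.
Local Notation C := R[i].

Lemma det_block_schur (F : comUnitRingType) n (a : 'M[F]_1) (r : 'rV[F]_n)
    (s : 'cV[F]_n) (D : 'M[F]_n) :
  D \in unitmx ->
  \det (block_mx a r s D) = (a - r *m invmx D *m s) 0 0 * \det D.
Proof.
move=> uD.
have -> : block_mx a r s D =
   block_mx 1%:M (r *m invmx D) 0 1%:M *m block_mx (a - r *m invmx D *m s) 0 s D.
  rewrite mulmx_block !mul1mx !mul0mx !add0r subrK.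
  by rewrite -[r *m invmx D *m D]mulmxA mulVmx// mulmx1.
by rewrite det_mulmx det_ublock !det1 !mul1r det_lblock det_mx11.
Qed.

(* Both sides are the determinant of [X = [1, - A; B, 1]]. *)
Lemma det_1DmxC (F : comNzRingType) m n (A : 'M[F]_(m, n)) (B : 'M[F]_(n, m)) :
  \det (1%:M + A *m B) = \det (1%:M + B *m A).
Proof.
pose X := block_mx 1%:M (- A) B 1%:M.
transitivity (\det X).
  have -> : X = block_mx 1%:M (- A) 0 1%:M *m block_mx (1%:M + A *m B) 0 B 1%:M.
    rewrite mulmx_block !mul1mx !mul0mx !add0r !mulmx1 mulNmx addrK.
    by [].
  by rewrite det_mulmx det_ublock det_lblock !det1 !mul1r mulr1.
have -> : X = block_mx 1%:M 0 B 1%:M *m block_mx 1%:M (- A) 0 (1%:M + B *m A).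
  by rewrite mulmx_block !mul1mx !mul0mx !addr0 !mulmx1 mulmxN addrCA addNr addr0.
by rewrite det_mulmx det_ublock det_lblock !det1 !mul1r.
Qed.

Lemma hform1 m (u : 'rV[C]_m) : hform 1%:M u = \sum_j nsq (u 0 j).
Proof.
rewrite /hform mulmx1 mxE (raddf_sum (@complex.Re R)); apply: eq_bigr => j _.
by rewrite !mxE; case: (u 0 j) => x y; rewrite /nsq/=; ring.
Qed.

Lemma posdef_1Dgram m n (B : 'M[C]_(m, n)) : posdefmx (1%:M + B *m B^t*).
Proof.
split; first by rewrite adjmxD adjmx1 adjmxM adjmxK.
move=> u u0; rewrite /hform mulmxDr mulmxDl mxE ReD.
rewrite ltr_pwDl//.
  rewrite -/(hform 1%:M u) hform1 lt_neqAle sumr_ge0 ?andbT; last by move=> *; exact: nsq_ge0.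
  rewrite eq_sym psumr_neq0; last by move=> *; exact: nsq_ge0.
  have /rV0Pn[j uj] := u0; apply/hasP; exists j; rewrite ?mem_index_enum//=.
  rewrite lt_neqAle nsq_ge0 andbT eq_sym; apply: contra uj.
  case: (u 0 j) => x y; rewrite /nsq/= paddr_eq0 ?sqr_ge0// !sqrf_eq0.
  by rewrite eq_complex.
have -> : complex.Re ((u *m (B *m B^t*) *m u^t*) 0 0) = hform 1%:M (u *m B).
  by rewrite /hform mulmx1 adjmxM !mulmxA.
rewrite hform1.
by rewrite sumr_ge0// => *; exact: nsq_ge0.
Qed.

Lemma posdef_inv m (S : 'M[C]_m) : posdefmx S -> posdefmx (invmx S).
Proof.
move=> pS; have uS := posdef_unit pS; have [hS pos] := pS.
have hV : (invmx S)^t* = invmx S.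
  have := congr1 (fun A : 'M[C]_m => A^t*) (mulmxV uS).
  rewrite adjmxM hS adjmx1 => h.
  by rewrite -[LHS]mulmx1 -(mulmxV uS) mulmxA h mul1mx.
split=> // u u0.
have -> : invmx S = invmx S *m S *m (invmx S)^t* by rewrite hV mulVmx// mul1mx.
rewrite hform_congr; apply: pos; apply: contra u0 => /eqP h.
by rewrite -[u]mulmx1 -(mulVmx uS) mulmxA h mul0mx.
Qed.

Definition gram_det n (T : 'M[C]_n) : R := complex.Re (\det (1%:M + T *m T^t*)).
Definition frob n (T : 'M[C]_n) : R := complex.Re (\tr (T^t* *m T)).

Lemma gram_det_gt0 n (T : 'M[C]_n) : 0 < gram_det T.
Proof. by have [] := posdef_det (posdef_1Dgram T). Qed.

Lemma posdef_1DgramC n (B : 'M[C]_n) : posdefmx (1%:M + B^t* *m B).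
Proof. by have := posdef_1Dgram (B^t*); rewrite adjmxK. Qed.

Lemma inv_1Dgram n (B : 'M[C]_n) :
  1%:M - B^t* *m invmx (1%:M + B *m B^t*) *m B = invmx (1%:M + B^t* *m B).
Proof.
have uD := posdef_unit (posdef_1Dgram B).
have uS := posdef_unit (posdef_1DgramC B).
set D := 1%:M + B *m B^t* in uD *; set S := 1%:M + B^t* *m B in uS *.
have SB : S *m B^t* = B^t* *m D.
  by rewrite /S /D mulmxDl mulmxDr mul1mx mulmx1 mulmxA.
have h : S *m (1%:M - B^t* *m invmx D *m B) = 1%:M.
  rewrite mulmxBr mulmx1 !mulmxA SB -(mulmxA _ D) mulmxV// mulmx1.
  by rewrite /S addrK.
by have := congr1 (mulmx (invmx S)) h; rewrite mulmxA mulVmx// mul1mx mulmx1.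
Qed.

Lemma gram_det_block n (x : C) (u : 'rV[C]_n) (B : 'M[C]_n) :
  gram_det (block_mx x%:M u 0 B : 'M[C]_(1 + n)) =
  (1 + nsq x + hform (invmx (1%:M + B^t* *m B)) u) * gram_det B.
Proof.
have uD := posdef_unit (posdef_1Dgram B).
rewrite /gram_det -inv_1Dgram.
rewrite (tr_block_mx x%:M u 0 B) map_block_mx mulmx_block.
rewrite !trmx0 !map_mx0 !mul0mx !mulmx0 !add0r.
rewrite [1%:M in LHS]scalar_mx_block add_block_mx !add0r det_block_schur//.
have [-> _] := posdef_det (posdef_1Dgram B).
rewrite mulrC ReZ mulrC; congr (_ * _).
rewrite /hform mulmxBr mulmx1 mulmxBl !mulmxA.
rewrite !mxE.
rewrite big_ord1 !(ReD, ReN).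
have -> : complex.Re ((0 == 0 :> 'I_1)%:R : C) = 1 by [].
have -> : complex.Re ((x%:M : 'M[C]_1) 0 0 * ((x%:M : 'M[C]_1)^t*) 0 0) = nsq x.
  by rewrite !mxE eqxx mulr1n; case: (x) => a b; rewrite /nsq/=; ring.
ring.
Qed.

Lemma frob_block n (x : C) (u : 'rV[C]_n) (B : 'M[C]_n) :
  frob (block_mx x%:M u 0 B : 'M[C]_(1 + n)) = nsq x + hform 1%:M u + frob B.
Proof.
rewrite /frob (mxtrace_mulC _ (block_mx _ _ _ _)).
rewrite (tr_block_mx x%:M u 0 B) map_block_mx mulmx_block.
rewrite !trmx0 !map_mx0 !mul0mx !mulmx0 !add0r.
rewrite mxtrace_block !raddfD/= (mxtrace_mulC B); congr (_ + _ + _).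
  rewrite /mxtrace big_ord1 mxE big_ord1 !mxE eqxx mulr1n.
  by case: (x) => a b; rewrite /nsq/=; ring.
by rewrite /hform mulmx1 /mxtrace big_ord1.
Qed.

Lemma frob_ge0 n (T : 'M[C]_n) : 0 <= frob T.
Proof.
rewrite /frob /mxtrace raddf_sum sumr_ge0// => i _.
rewrite mxE raddf_sum sumr_ge0// => j _; rewrite !mxE.
by case: (T j i) => a b /=; rewrite mulNr opprK -!expr2 addr_ge0 ?sqr_ge0.
Qed.

Lemma inv_gram_det n (B : 'M[C]_n) :
  complex.Re (\det (invmx (1%:M + B^t* *m B))) = (gram_det B)^-1.
Proof.
rewrite det_inv -det_1DmxC /gram_det.
have [-> _] := posdef_det (posdef_1Dgram B).
by rewrite -fmorphV.
Qed.

Lemma tr_1Dgram n (B : 'M[C]_n) :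
  complex.Re (\tr (1%:M *m invmx (invmx (1%:M + B^t* *m B)))) = n%:R + frob B.
Proof.
rewrite invmxK mul1mx mxtraceD mxtrace1 ReD /frob; congr (_ + _).
by rewrite -(rmorph_nat (@real_complex R)).
Qed.


End block_det.

Section schur_integral.
Context {R : realType}.
Local Notation C := R[i].
Local Notation muCn := (lebesgue_Cn R).

Lemma measurable_nth_tuple k i : measurable_fun setT (fun t : k.-tuple C => nth 0 t i).
Proof.
have [ik|ki] := ltnP i k.
  rewrite (_ : (fun _ => _) = fun t : k.-tuple C => tnth t (Ordinal ik)).
    exact: measurable_tnth.
  by apply/funext => t; rewrite (tnth_nth 0).
rewrite (_ : (fun _ => _) = cst 0); first exact: measurable_cst.
by apply/funext => t; rewrite nth_default// size_tuple.
Qed.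

Lemma measurable_upper_seq k n l :
  measurable_mx (fun t : k.-tuple C => upper_seq n l t).
Proof.
move=> i j; rewrite (_ : (fun t => _) = fun t : k.-tuple C =>
  if i == j then nth 0 l i
    else if (i < j)%N then nth 0 t (index (i, j) (strict_upper_positions n))
    else 0); last by apply/funext => t; rewrite mxE.
case: (i == j); first exact: measurable_cst.
case: (i < j)%N; last exact: measurable_cst.
exact: measurable_nth_tuple.
Qed.

Lemma measurable_gram_det d (T : measurableType d) n (F : T -> 'M[C]_n) :
  measurable_mx F -> measurable_fun setT (fun t => gram_det (F t)).
Proof.
move=> mF; apply: measurable_complexRe; apply: measurable_mx_det.
apply: measurable_mxD; first exact: measurable_mx_cst.
by apply: measurable_mxM => //; exact: measurable_mx_adj.
Qed.

Lemma measurable_frob d (T : measurableType d) n (F : T -> 'M[C]_n) :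
  measurable_mx F -> measurable_fun setT (fun t => frob (F t)).
Proof.
move=> mF; apply: measurable_complexRe; apply: measurable_mx_trace.
by apply: measurable_mxM => //; exact: measurable_mx_adj.
Qed.

Lemma ge0_integral_Cn_cat_swap m n k (e : k = (m + n)%N) (f : seq C -> \bar R) :
  (forall k, measurable_fun setT (fun t : k.-tuple C => f t)) ->
  (forall t, 0 <= f t)%E ->
  (\int[muCn k]_t f t = \int[muCn n]_v \int[muCn m]_u f (u ++ v))%E.
Proof.
move=> mf f0; rewrite (ge0_integral_Cn_cat e)//.
rewrite (@fubini_tonelli _ _ _ _ _ (muCn m) (muCn n)
  (fun p : m.-tuple C * n.-tuple C => f (p.1 ++ p.2)))//.
exact: (measurableT_comp (mf (m + n)%N) (@measurable_tuple_cat _ m n)).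
Qed.

Definition schur_weight n N (l t : seq C) : R := gram_det (upper_seq n l t) ^- (n + N).

Lemma schur_weight_gt0 n N l t : 0 < schur_weight n N l t.
Proof. by rewrite invr_gt0 exprn_gt0// gram_det_gt0. Qed.

Lemma measurable_schur_weight n N l k :
  measurable_fun setT (fun t : k.-tuple C => schur_weight n N l t).
Proof.
apply: measurable_funV; apply: measurable_funX; apply: measurable_gram_det.
exact: measurable_upper_seq.
Qed.

Lemma measurable_frob_upper n l k :
  measurable_fun setT (fun t : k.-tuple C => frob (upper_seq n l t)).
Proof. by apply: measurable_frob; exact: measurable_upper_seq. Qed.

(* The mean of [frob] under [schur_weight]; for [n = N] it equals [N] times the
   formula of the theorem. *)
Definition schur_formula n N (l : seq C) : R :=
  N%:R * \prod_(i < n) (1 + (1 + nsq (nth 0 l i)) / N%:R) - N%:R - n%:R.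

Lemma schur_formulaS n N x l : (0 < N)%N ->
  schur_formula n.+1 N (x :: l) =
  (nsq x + (1 + nsq x) * n%:R / N%:R) + (1 + (1 + nsq x) / N%:R) * schur_formula n N l.
Proof.
move=> N0; rewrite /schur_formula big_ord_recl /= -[n.+1%:R]natr1.
set P := \prod_(i < n) _; clearbody P.
by field; rewrite pnatr_eq0 -lt0n.
Qed.

Lemma schur_integral n N (l : seq C) : (0 < N)%N -> size l = n ->
  exists2 W : R, 0 < W &
  (\int[muCn (upper_dim n)]_t (schur_weight n N l t)%:E = W%:E)%E /\
  (\int[muCn (upper_dim n)]_t (frob (upper_seq n l t) * schur_weight n N l t)%:E =
   (W * schur_formula n N l)%:E)%E.
Proof.
move=> N0; elim: n l => [|n IH] [|x l]// => [_|[sl]].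
  exists 1 => //.
  rewrite (_ : upper_dim 0 = 0%N); last first.
    apply/eqP; rewrite /upper_dim /strict_upper_positions size_filter -leqn0.
    by apply: (leq_trans (count_size _ _)); rewrite -cardE card_prod card_ord.
  rewrite !ge0_integral_Cn0 /schur_weight /gram_det det_mx00/= expr1n invr1; split=> //.
  by rewrite /frob /mxtrace big_ord0/= mul0r /schur_formula big_ord0 mulr1 subrr subr0 mulr0.
have [W' W'0 [I1 I2]] := IH _ sl.
set c := 1 + nsq x.
have c0 : 0 < c by rewrite ltr_pwDl// nsq_ge0.
pose Z : R := hform_const n N * c ^- N.+1.
have Z0 : 0 < Z by rewrite mulr_gt0 ?invr_gt0 ?exprn_gt0// hform_const_gt0.
pose V (v : seq C) : 'M[C]_n := invmx (1%:M + (upper_seq n l v)^t* *m upper_seq n l v).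
have pV v : posdefmx (V v) by apply: posdef_inv; exact: posdef_1DgramC.
pose D (v : seq C) := gram_det (upper_seq n l v).
have D0 v : 0 < D v by exact: gram_det_gt0.
have weightE (u : n.-tuple C) v : schur_weight n.+1 N (x :: l) (u ++ v) =
    D v ^- (n + N).+1 * (c + hform (V v) (row_of_tuple u)) ^- (n + N).+1.
  by rewrite /schur_weight upper_seqS gram_det_block addSn exprMn invfM mulrC.
have pow0 v (u : n.-tuple C) i : 0 <= (c + hform (V v) (row_of_tuple u)) ^- i.
  by rewrite invr_ge0 exprn_ge0// addr_ge0 ?(ltW c0)//; exact: posdef_psd.
have Dpow0 v i : 0 <= D v ^- i by rewrite invr_ge0 exprn_ge0// ltW.
have mpow v : measurable_fun setT (fun u : n.-tuple C =>
    ((c + hform (V v) (row_of_tuple u)) ^- (n + N).+1)%:E).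
  by apply/measurable_EFinP; exact: measurable_hform_pow.
have inner1 v : (\int[muCn n]_u (schur_weight n.+1 N (x :: l) (u ++ v))%:E =
    (Z * schur_weight n N l v)%:E)%E.
  under eq_integral do rewrite weightE EFinM.
  rewrite ge0_integralZl//; try by [move=> u _; rewrite lee_fin|rewrite lee_fin].
  rewrite integral_hform// inv_gram_det -/(D v) -EFinM; congr EFin.
  rewrite /Z /schur_weight -/(D v) exprS.
  set h := hform_const n N; clearbody h.
  have w0 : D v ^+ (n + N) != 0 by rewrite gt_eqF// exprn_gt0.
  have d0 := D0 v; have y0 : c ^+ N.+1 != 0 by rewrite gt_eqF// exprn_gt0.
  set w := D v ^+ (n + N) in w0 *; set d := D v in d0 *; set y := c ^+ N.+1 in y0 *.
  by field; rewrite w0 y0 gt_eqF.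
have inner2 v : (\int[muCn n]_u (frob (upper_seq n.+1 (x :: l) (u ++ v)) *
      schur_weight n.+1 N (x :: l) (u ++ v))%:E =
    (Z * ((nsq x + c * n%:R / N%:R) * schur_weight n N l v +
          (1 + c / N%:R) * (frob (upper_seq n l v) * schur_weight n N l v)))%:E)%E.
  set q := frob (upper_seq n l v); have q0 : 0 <= q by exact: frob_ge0.
  transitivity (\int[muCn n]_u (((nsq x + q) * D v ^- (n + N).+1)%:E *
        ((c + hform (V v) (row_of_tuple u)) ^- (n + N).+1)%:E +
      (D v ^- (n + N).+1)%:E * (hform 1%:M (row_of_tuple u) *
        (c + hform (V v) (row_of_tuple u)) ^- (n + N).+1)%:E))%E.
    apply: eq_integral => u _; rewrite weightE upper_seqS frob_block -/q.
    by rewrite -!EFinM -EFinD; congr EFin; ring.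
  have h0 (u : 'rV[C]_n) : 0 <= hform 1%:M u.
    by rewrite hform1 sumr_ge0// => j _; exact: nsq_ge0.
  have mh : measurable_fun setT (fun u : n.-tuple C => (hform 1%:M (row_of_tuple u) *
        (c + hform (V v) (row_of_tuple u)) ^- (n + N).+1)%:E).
    by apply/measurable_EFinP; apply: measurable_funM;
      [exact: measurable_hform_tuple|exact: measurable_hform_pow].
  have e0 : 0 <= (nsq x + q) * D v ^- (n + N).+1 by rewrite mulr_ge0// addr_ge0// nsq_ge0.
  rewrite ge0_integralD//; try by [exact: measurable_funeM|
    move=> u _; rewrite mule_ge0// lee_fin// mulr_ge0].
  rewrite ge0_integralZl//; try by [move=> u _; rewrite lee_fin|rewrite lee_fin].
  rewrite ge0_integralZl//; try by [move=> u _; rewrite lee_fin mulr_ge0|rewrite lee_fin].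
  rewrite integral_hform// integral_hformM// inv_gram_det tr_1Dgram -/q -/(D v).
  rewrite -!EFinM -EFinD; congr EFin.
  rewrite /Z /schur_weight -/(D v) !exprS.
  set h := hform_const n N; clearbody h.
  have w0 : D v ^+ (n + N) != 0 by rewrite gt_eqF// exprn_gt0.
  have d0 := D0 v; have y0 : c ^+ N != 0 by rewrite gt_eqF// exprn_gt0.
  set w := D v ^+ (n + N) in w0 *; set d := D v in d0 *; set y := c ^+ N in y0 *.
  move: (nsq x) => s; clearbody w d y c q.
  by field; rewrite w0 y0 (gt_eqF c0) (gt_eqF d0) pnatr_eq0 -lt0n N0.
have sw0 m k t : 0 <= schur_weight m N k t by rewrite ltW// schur_weight_gt0.
have msw k m r : measurable_fun setT (fun t : k.-tuple C => (schur_weight m N r t)%:E).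
  by apply/measurable_EFinP; exact: measurable_schur_weight.
have mfr k m r : measurable_fun setT
    (fun t : k.-tuple C => (frob (upper_seq m r t) * schur_weight m N r t)%:E).
  apply/measurable_EFinP; apply: measurable_funM.
    exact: measurable_frob_upper.
  exact: measurable_schur_weight.
exists (Z * W'); first by rewrite mulr_gt0.
split.
  rewrite (ge0_integral_Cn_cat_swap (upper_dimS n)
    (f := fun t => (schur_weight n.+1 N (x :: l) t)%:E))//; last by move=> t; rewrite lee_fin.
  under eq_integral do rewrite inner1 EFinM.
  rewrite ge0_integralZl//; try by [exact: msw|move=> t _; rewrite lee_fin|rewrite lee_fin ltW].
  by rewrite I1 EFinM.
rewrite (ge0_integral_Cn_cat_swap (upper_dimS n)
  (f := fun t => (frob (upper_seq n.+1 (x :: l) t) * schur_weight n.+1 N (x :: l) t)%:E))//;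
  last by move=> t; rewrite lee_fin mulr_ge0// frob_ge0.
have a0 : 0 <= nsq x + c * n%:R / N%:R.
  by rewrite addr_ge0 ?nsq_ge0// !mulr_ge0// ?invr_ge0// ltW.
have b0 : 0 <= 1 + c / N%:R by rewrite addr_ge0// mulr_ge0 ?invr_ge0// ltW.
under eq_integral do rewrite inner2 EFinM EFinD [X in (_ + X)%E]EFinM [X in (X + _)%E]EFinM.
rewrite ge0_integralZl//; try by [
  apply: emeasurable_funD; apply: measurable_funeM; [exact: msw|exact: mfr]|
  move=> t _; rewrite adde_ge0// mule_ge0// lee_fin// mulr_ge0// frob_ge0|
  rewrite lee_fin ltW].
rewrite ge0_integralD//; try by [
  apply: measurable_funeM; exact: msw|
  apply: measurable_funeM; exact: mfr|
  move=> t _; rewrite mule_ge0// lee_fin// mulr_ge0// frob_ge0].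
rewrite ge0_integralZl//; try by [exact: msw|move=> t _; rewrite lee_fin].
rewrite ge0_integralZl//; try by [exact: mfr|move=> t _; rewrite lee_fin mulr_ge0// frob_ge0].
rewrite I1 I2 schur_formulaS// -/c -!EFinM; congr EFin; ring.
Qed.
End schur_integral.

(** * Conditioning on the spectrum *)

Section conditional.
Context {R : realType}.
Local Notation C := R[i].
Local Notation muCn := (lebesgue_Cn R).

Definition vdm N (lam : N.-tuple C) : R :=
  \prod_(i < N) \prod_(j < N | (i < j)%N)
    ComplexField.Normc.normc (tnth lam i - tnth lam j) ^+ 2.

Lemma normc_sqr (z : C) : ComplexField.Normc.normc z ^+ 2 = nsq z.
Proof. by case: z => x y /=; rewrite sqr_sqrtr// addr_ge0 ?sqr_ge0. Qed.

Lemma vdm_ge0 N (lam : N.-tuple C) : 0 <= vdm lam.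
Proof. by do 2 (apply: prodr_ge0 => ? _); rewrite sqr_ge0. Qed.

Lemma nsq_eq0 (z : C) : (nsq z == 0) = (z == 0).
Proof. by case: z => x y; rewrite /nsq/= paddr_eq0 ?sqr_ge0// !sqrf_eq0 eq_complex. Qed.

Lemma vdm_gt0 N (lam : N.-tuple C) : uniq lam -> 0 < vdm lam.
Proof.
move=> ul; apply: prodr_gt0 => i _; apply: prodr_gt0 => j ij.
rewrite normc_sqr lt_neqAle nsq_ge0 andbT eq_sym nsq_eq0 subr_eq0.
apply/eqP => /(tuple_uniqP _ ul) e; by rewrite e ltnn in ij.
Qed.

Lemma schur_densityE N (lam : N.-tuple C) (t : (upper_dim N).-tuple C) :
  schur_density (upper_mx lam t) = vdm lam * schur_weight N N lam t.
Proof.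
rewrite /schur_density /schur_weight /gram_det -upper_mxE mul2n addnn; congr (_ * _).
by apply: eq_bigr => i _; apply: eq_bigr => j _; rewrite !mxE !eqxx.
Qed.

Lemma schur_density_ge0 N (lam : N.-tuple C) (t : (upper_dim N).-tuple C) :
  0 <= schur_density (upper_mx lam t).
Proof. by rewrite schur_densityE mulr_ge0 ?vdm_ge0// ltW// schur_weight_gt0. Qed.

Lemma normalized_trace_sqE N (M : 'M[C]_N) : normalized_trace_sq M = N%:R^-1 * frob M.
Proof. by []. Qed.

Definition spherical_formula N (lam : N.-tuple C) : R :=
  \prod_(i < N)
      (1 + (1 + ComplexField.Normc.normc (tnth lam i) ^+ 2) / N%:R) - 2.

Lemma spherical_formulaE N (lam : N.-tuple C) : (0 < N)%N ->
  spherical_formula lam = N%:R^-1 * schur_formula N N lam.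
Proof.
move=> N0; rewrite /spherical_formula /schur_formula.
under eq_bigr do rewrite normc_sqr (tnth_nth 0).
set p := \prod_(i < N) _; clearbody p.
by field; rewrite pnatr_eq0 -lt0n.
Qed.

Lemma integral_schur_density N (lam : N.-tuple C) : (0 < N)%N ->
  exists2 W : R, 0 < W &
  (\int[muCn (upper_dim N)]_t (schur_density (upper_mx lam t))%:E = (vdm lam * W)%:E)%E /\
  (\int[muCn (upper_dim N)]_t
     (normalized_trace_sq (upper_mx lam t) * schur_density (upper_mx lam t))%:E
   = (spherical_formula lam * (vdm lam * W))%:E)%E.
Proof.
move=> N0; have [W W0 [I1 I2]] := schur_integral N0 (size_tuple lam).
have sw0 t : 0 <= schur_weight N N lam t by rewrite ltW// schur_weight_gt0.
exists W => //; split.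
  under eq_integral do rewrite schur_densityE EFinM.
  rewrite ge0_integralZl//; try by [
    apply/measurable_EFinP; exact: measurable_schur_weight|
    move=> t _; rewrite lee_fin| rewrite lee_fin vdm_ge0].
  by rewrite I1.
transitivity (\int[muCn (upper_dim N)]_t ((N%:R^-1 * vdm lam)%:E *
    (frob (upper_seq N lam t) * schur_weight N N lam t)%:E))%E.
  apply: eq_integral => t _; rewrite schur_densityE normalized_trace_sqE upper_mxE.
  by rewrite -EFinM; congr EFin; ring.
rewrite ge0_integralZl//; try by [
  apply/measurable_EFinP; apply: measurable_funM;
    [exact: measurable_frob_upper|exact: measurable_schur_weight]|
  move=> t _; rewrite lee_fin mulr_ge0// frob_ge0|
  rewrite lee_fin mulr_ge0 ?invr_ge0// vdm_ge0].
by rewrite I2 spherical_formulaE// -EFinM; congr EFin; ring.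
Qed.

Lemma spherical_formula_ge0 N (lam : N.-tuple C) : (0 < N)%N -> 0 <= spherical_formula lam.
Proof.
move=> N0; have [W W0 [_ I2]] := schur_integral N0 (size_tuple lam).
rewrite spherical_formulaE// mulr_ge0 ?invr_ge0//.
rewrite -(pmulr_rge0 _ W0) -lee_fin -I2; apply: integral_ge0 => t _.
by rewrite lee_fin mulr_ge0 ?frob_ge0// ltW// schur_weight_gt0.
Qed.

Lemma schur_condE_formula N (lam : N.-tuple C) : (0 < N)%N -> uniq lam ->
  schur_condE lam (@normalized_trace_sq R N) = (spherical_formula lam)%:E.
Proof.
move=> N0 ul; have [W W0 [I1 I2]] := integral_schur_density lam N0.
have v0 := vdm_gt0 ul.
rewrite /schur_condE I1 I2 inver gt_eqF ?mulr_gt0// -EFinM; congr EFin.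
by rewrite mulfK// gt_eqF// mulr_gt0.
Qed.

End conditional.

Lemma measurable_indic_comp d1 d2 (X : measurableType d1) (Y : measurableType d2)
    (R : realType) (h : X -> Y) (A : set Y) :
  measurable_fun setT h -> measurable A ->
  measurable_fun setT (fun x => \1_A (h x) : R).
Proof.
move=> mh mA; rewrite (_ : (fun _ => _) = \1_(h @^-1` A))//.
by apply: measurable_indic; rewrite -[X in measurable X]setTI; exact: mh.
Qed.

Section density_law.
Context d1 d2 d3 (X : measurableType d1) (Y : measurableType d2)
  (Z : measurableType d3) (R : realType).
Variables (P : {measure set X -> \bar R}) (m : {measure set Z -> \bar R}).
Variables (T : X -> Y) (phi : Z -> Y) (dens : Z -> R).
Hypotheses (mT : measurable_fun setT T) (mphi : measurable_fun setT phi).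
Hypotheses (mdens : measurable_fun setT dens) (dens0 : forall z, 0 <= dens z).
Hypothesis law : forall A, measurable A ->
  P (T @^-1` A) = (\int[m]_z (\1_A (phi z) * dens z)%:E)%E.

Import HBNNSimple.

Lemma ge0_integral_density_law (g : Y -> \bar R) :
  measurable_fun setT g -> (forall y, 0 <= g y)%E ->
  (\int[P]_w g (T w) = \int[m]_z (g (phi z) * (dens z)%:E))%E.
Proof.
move=> mg g0.
pose f_ := nnsfun_approx measurableT mg.
have cvgf y : (f_ n y)%:E @[n --> \oo] --> g y.
  by apply: (@cvg_nnsfun_approx _ _ _ _ measurableT _ mg (fun y _ => g0 y)).
have ndf y : {homo (fun n => f_ n y) : a b / (a <= b)%N >-> a <= b}.
  by move=> a b ab; exact/lefP/nd_nnsfun_approx.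
have E n : (\int[P]_w (f_ n (T w))%:E = \int[m]_z (f_ n (phi z) * dens z)%:E)%E.
  have mI (r : R) : measurable (f_ n @^-1` [set r]) by [].
  have r0 (r : R) y : 0 <= r * \1_(f_ n @^-1` [set r]) y.
    by rewrite -lee_fin EFinM; exact: nnfun_muleindic_ge0.
  have rr (r : R) : r \in range (f_ n) -> 0 <= r.
    by rewrite inE => -[y _ <-].
  transitivity (\sum_(r \in range (f_ n)) (r%:E * P (T @^-1` (f_ n @^-1` [set r]))))%E.
    transitivity (\int[P]_w (\sum_(r \in range (f_ n))
        (r * \1_(f_ n @^-1` [set r]) (T w))%:E))%E.
      by apply: eq_integral => w _; rewrite fimfunE -fsumEFin.
    rewrite ge0_integral_fsum//; last 2 first.
    - move=> r; apply/measurable_EFinP; apply: measurable_funM => //.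
      exact: measurable_indic_comp.
    - by move=> r w _; rewrite lee_fin.
    apply: eq_fsbigr => r /rr r_ge0.
    under eq_integral do rewrite EFinM.
    rewrite ge0_integralZl//; last by apply/measurable_EFinP; exact: measurable_indic_comp.
    congr (_ * _)%E.
    transitivity (\int[P]_w (\1_(T @^-1` (f_ n @^-1` [set r])) w)%:E)%E; first by [].
    rewrite integral_indic ?setIT//.
    by rewrite -[X in measurable X]setTI; exact: mT.
  transitivity (\int[m]_z (\sum_(r \in range (f_ n))
      (r * \1_(f_ n @^-1` [set r]) (phi z) * dens z)%:E))%E.
    rewrite ge0_integral_fsum//; last 2 first.
    - move=> r; apply/measurable_EFinP; apply: measurable_funM => //.
      by apply: measurable_funM => //; exact: measurable_indic_comp.
    - by move=> r z _; rewrite lee_fin mulr_ge0.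
    apply: eq_fsbigr => r /rr r_ge0; rewrite law//.
    rewrite -ge0_integralZl//; last 2 first.
    - apply/measurable_EFinP; apply: measurable_funM => //; exact: measurable_indic_comp.
    - by move=> z _; rewrite lee_fin mulr_ge0// indicE.
    by apply: eq_integral => z _; rewrite -EFinM mulrA.
  apply: eq_integral => z _; rewrite fsumEFin//; congr EFin.
  rewrite -mulr_fsuml; congr (_ * _); by rewrite fimfunE.
transitivity (limn (fun n => \int[P]_w (f_ n (T w))%:E))%E.
  rewrite -monotone_convergence//.
  - by apply: eq_integral => w _; apply/esym/cvg_lim => //; exact: cvgf.
  - by move=> n; apply/measurable_EFinP; apply: measurableT_comp.
  - by move=> n w _; rewrite lee_fin.
  - by move=> w _ a b ab; rewrite lee_fin; exact: ndf.
under eq_fun do rewrite E.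
rewrite -monotone_convergence//.
- apply: eq_integral => z _; apply/cvg_lim => //.
  under eq_fun do rewrite EFinM.
  by apply: cvgeZr => //; exact: cvgf.
- move=> n; apply/measurable_EFinP; apply: measurable_funM => //.
  exact: measurableT_comp.
- by move=> n z _; rewrite lee_fin mulr_ge0.
- by move=> z _ a b ab; rewrite lee_fin ler_wpM2r//; exact: ndf.
Qed.
End density_law.

Section matrix_measurability.
Context {R : realType}.
Local Notation C := R[i].

Lemma measurable_mxP d (T : measurableType d) m n (F : T -> 'M[C]_(m, n)) :
  measurable_mx F -> measurable_fun setT F.
Proof.
move=> mF; apply: (@measurability _ _ _ _ _ _ (@matrix_cylinders _ C m n)) => //.
move=> _ [_ [i [j [B mB ->]]] <-].
exact: (mF i j measurableT B mB).
Qed.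

Lemma measurable_mx_id m n : measurable_mx (fun M : 'M[C]_(m, n) => M).
Proof.
move=> i j _ B mB; rewrite setTI; apply: sub_sigma_algebra.
by exists i, j, B.
Qed.

Definition diag_tuple N (M : 'M[C]_N) : N.-tuple C := [tuple M i i | i < N].

Lemma measurable_diag_tuple N : measurable_fun setT (@diag_tuple N).
Proof.
apply/measurable_fun_tnthP => i.
rewrite (_ : _ \o _ = fun M : 'M[C]_N => M i i); first exact: measurable_mx_id.
by apply/funext => M /=; rewrite tnth_mktuple.
Qed.

Lemma diag_upper_mx N (lam : N.-tuple C) t : diag_tuple (upper_mx lam t) = lam.
Proof.
by apply: eq_from_tnth => i; rewrite tnth_mktuple mxE eqxx.
Qed.

Lemma measurable_upper_mx N : measurable_fun setT
  (fun p : N.-tuple C * (upper_dim N).-tuple C => upper_mx p.1 p.2).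
Proof.
apply: measurable_mxP => i j.
rewrite (_ : (fun _ => _) = fun p : N.-tuple C * (upper_dim N).-tuple C =>
  if i == j then tnth p.1 i
    else if (i < j)%N then nth 0 p.2 (index (i, j) (strict_upper_positions N))
    else 0); last by apply/funext => p; rewrite mxE.
case: (i == j).
  by apply: (measurableT_comp (measurable_tnth i)).
case: (i < j)%N; last exact: measurable_cst.
exact: (measurableT_comp (@measurable_nth_tuple R (upper_dim N) _) (@measurable_snd _ _ _ _)).
Qed.

Lemma measurable_normalized_trace_sq N :
  measurable_fun setT (@normalized_trace_sq R N).
Proof.
apply: measurable_funM; first exact: measurable_cst.
apply: measurable_frob; exact: measurable_mx_id.
Qed.

Lemma measurable_spherical_formula N :
  measurable_fun setT (@spherical_formula R N).
Proof.
apply: measurable_funB; last exact: measurable_cst.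
apply: measurable_prod => i _; apply: measurable_funD; first exact: measurable_cst.
apply: measurable_funM; last exact: measurable_cst.
apply: measurable_funD; first exact: measurable_cst.
under eq_fun do rewrite normc_sqr.
by apply: (measurableT_comp (@measurable_nsq R)); exact: measurable_tnth.
Qed.

Lemma measurable_schur_density_upper N : measurable_fun setT
  (fun p : N.-tuple C * (upper_dim N).-tuple C => schur_density (upper_mx p.1 p.2)).
Proof.
apply: (measurableT_comp (f := @schur_density R N)); last exact: measurable_upper_mx.
apply: measurable_funM.
  apply: measurable_prod => i _; under eq_fun do rewrite big_mkcond/=.
  apply: measurable_prod => j _; case: (i < j)%N; last exact: measurable_cst.
  under eq_fun do rewrite normc_sqr.
  apply: (measurableT_comp (@measurable_nsq R)); apply: measurable_complexD.
    exact: measurable_mx_id.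
  by apply: measurable_complexN; exact: measurable_mx_id.
apply: measurable_funV; apply: measurable_funX; apply: measurable_gram_det.
exact: measurable_mx_id.
Qed.

Lemma normalized_trace_sq_conj N (U T : 'M[C]_N) : U \is unitarymx ->
  normalized_trace_sq (U *m T *m U^t*) = normalized_trace_sq T.
Proof.
move=> /unitarymxP UU; have UU' := mulmx1C UU.
rewrite !normalized_trace_sqE /frob !adjmxM adjmxK !mulmxA.
rewrite -(mulmxA _ (U^t*) U) UU' mulmx1 mxtrace_mulC !mulmxA UU' mul1mx.
by [].
Qed.

Lemma normalized_trace_sq_ge0 N (M : 'M[C]_N) : 0 <= normalized_trace_sq M.
Proof. by rewrite normalized_trace_sqE mulr_ge0 ?invr_ge0// frob_ge0. Qed.

End matrix_measurability.

Section condE.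
Context {R : realType} d (Omega : measurableType d) (P : probability Omega R) (N : nat).
Local Notation C := R[i].
Variables (G U T : {RV P >-> 'M[C]_N}) (Lam : {RV P >-> N.-tuple C}).
Hypotheses (N0 : (0 < N)%N) (sf : schur_form P G Lam U T).

Lemma Lam_diag w : Lam w = diag_tuple (T w).
Proof. by apply: eq_from_tnth => i; rewrite tnth_mktuple (schur_diag sf). Qed.

Lemma is_condE_spherical_formula :
  is_condE P (fun w => normalized_trace_sq (G w)) Lam (@spherical_formula R N).
Proof.
split; first exact: measurable_spherical_formula.
move=> B mB.
have [c c0 law] := schur_law sf.
pose dens (p : N.-tuple C * (upper_dim N).-tuple C) := c * schur_density (upper_mx p.1 p.2).
have dens0 p : 0 <= dens p by rewrite mulr_ge0 ?schur_density_ge0// ltW.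
have mdens : measurable_fun setT dens.
  by apply: measurable_funM => //; exact: measurable_schur_density_upper.
have lawd (A : set 'M[C]_N) : measurable A -> P (T @^-1` A) =
    (\int[lebesgue_Cn R N \x lebesgue_Cn R (upper_dim N)]_p
      (\1_A (upper_mx p.1 p.2) * dens p)%:E)%E.
  move=> mA; rewrite law// -ge0_integralZl//; last 3 first.
  - apply/measurable_EFinP; apply: measurable_funM.
      by apply: measurable_indic_comp => //; exact: measurable_upper_mx.
    exact: measurable_schur_density_upper.
  - by move=> p _; rewrite lee_fin mulr_ge0 ?schur_density_ge0// indicE.
  - by rewrite lee_fin ltW.
  by apply: eq_integral => p _; rewrite -EFinM mulrCA.
pose g1 (M : 'M[C]_N) : \bar R := (normalized_trace_sq M * \1_B (diag_tuple M))%:E.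
pose g2 (M : 'M[C]_N) : \bar R := (spherical_formula (diag_tuple M) * \1_B (diag_tuple M))%:E.
have mind : measurable_fun setT (fun M : 'M[C]_N => \1_B (diag_tuple M) : R).
  by apply: measurable_indic_comp => //; exact: measurable_diag_tuple.
have mg1 : measurable_fun setT g1.
  apply/measurable_EFinP; apply: measurable_funM => //.
  exact: measurable_normalized_trace_sq.
have mg2 : measurable_fun setT g2.
  apply/measurable_EFinP; apply: measurable_funM => //.
  apply: (measurableT_comp (@measurable_spherical_formula R N)).
  exact: measurable_diag_tuple.
have g10 M : (0 <= g1 M)%E by rewrite lee_fin mulr_ge0 ?normalized_trace_sq_ge0// indicE.
have g20 M : (0 <= g2 M)%E by rewrite lee_fin mulr_ge0 ?spherical_formula_ge0// indicE.
have mT : measurable_fun setT T by [].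
transitivity (\int[P]_w g1 (T w))%E.
  rewrite integral_mkcond; apply: eq_integral => w _; rewrite patchE /g1 -Lam_diag.
  rewrite indicE (schur_eq sf) normalized_trace_sq_conj ?(schur_unitary sf)//.
  rewrite (_ : (w \in Lam @^-1` B) = (Lam w \in B)); last by apply/idP/idP; rewrite !inE.
  by case: ifP => _; rewrite ?mulr1 ?mulr0.
transitivity (\int[P]_w g2 (T w))%E; last first.
  rewrite [RHS]integral_mkcond; apply: eq_integral => w _; rewrite patchE /g2 -Lam_diag.
  rewrite indicE (_ : (w \in Lam @^-1` B) = (Lam w \in B)); last by apply/idP/idP; rewrite !inE.
  by case: ifP => _; rewrite ?mulr1 ?mulr0.
rewrite (ge0_integral_density_law mT (@measurable_upper_mx R N) mdens dens0 lawd mg1 g10).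
rewrite (ge0_integral_density_law mT (@measurable_upper_mx R N) mdens dens0 lawd mg2 g20).
have mgd (g : 'M[C]_N -> \bar R) : measurable_fun setT g -> measurable_fun setT
   (fun p : N.-tuple C * (upper_dim N).-tuple C => (g (upper_mx p.1 p.2) * (dens p)%:E)%E).
  move=> mg; apply: emeasurable_funM; last exact/measurable_EFinP.
  by apply: (measurableT_comp mg); exact: measurable_upper_mx.
rewrite (fubini_tonelli1 _ (mgd _ mg1)); last by move=> p; rewrite mule_ge0// lee_fin.
rewrite (fubini_tonelli1 _ (mgd _ mg2)); last by move=> p; rewrite mule_ge0// lee_fin.
apply: eq_integral => lam _; rewrite /fubini_F /=.
have [W W0 [I1 I2]] := integral_schur_density lam N0.
have mdl : measurable_fun setT (fun t : (upper_dim N).-tuple C => schur_density (upper_mx lam t)).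
  exact: (measurableT_comp (@measurable_schur_density_upper R N) (pair1_measurable lam)).
have mul' : measurable_fun setT (fun t : (upper_dim N).-tuple C => upper_mx lam t).
  exact: (measurableT_comp (@measurable_upper_mx R N) (pair1_measurable lam)).
have b0 : 0 <= \1_B lam * c :> R by rewrite mulr_ge0 ?(ltW c0)// indicE.
transitivity ((\1_B lam * c)%:E * (spherical_formula lam * (vdm lam * W))%:E)%E.
  rewrite -I2 -ge0_integralZl//; last 2 first.
  - apply/measurable_EFinP; apply: measurable_funM => //.
    exact: (measurableT_comp (@measurable_normalized_trace_sq R N) mul').
  - by move=> t _; rewrite lee_fin mulr_ge0 ?schur_density_ge0// normalized_trace_sq_ge0.
  apply: eq_integral => t _; rewrite /g1 /dens diag_upper_mx -!EFinM; congr EFin; ring.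
rewrite [(spherical_formula lam * _)%:E]EFinM muleA -I1 -EFinM -ge0_integralZl//; last 3 first.
- by apply/measurable_EFinP.
- by move=> t _; rewrite lee_fin schur_density_ge0.
- by rewrite lee_fin mulr_ge0// spherical_formula_ge0.
apply: eq_integral => t _; rewrite /g2 /dens diag_upper_mx -!EFinM; congr EFin; ring.
Qed.

End condE.

Theorem proposition2p12 (R : realType) (d : measure_display)
    (Omega : measurableType d) (P : probability Omega R) (N : nat)
    (G U T : {RV P >-> 'M[R[i]]_N}) (Lam : {RV P >-> N.-tuple R[i]}) :
  (0 < N)%N ->
  spherical_ensemble (distribution P G) ->
  exchangeable_spectrum P G Lam ->
  schur_form P G Lam U T ->
  let formula (lam : N.-tuple R[i]) : R :=
    \prod_(i < N)
      (1 + (1 + ComplexField.Normc.normc (tnth lam i) ^+ 2) / N%:R) - 2 in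
  (forall lam : N.-tuple R[i], uniq lam ->
     schur_condE lam (@normalized_trace_sq R N) = (formula lam)%:E) /\
  is_condE P (fun w => normalized_trace_sq (G w)) Lam formula.
Proof.
move=> N0 _ _ sf formula; split=> [lam|].
  exact: schur_condE_formula.
exact: is_condE_spherical_formula sf.
Qed.
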